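(* A connected graph $G$ is a cograph if and only if its split tree $ST(G)$ is equal (as a graph-labelled tree, up to isomorphism fixing the leaves) to its modular graph-labelled tree, and this tree is a clique-star tree (all labels are cliques or stars).
   Context: A cograph is a graph with no induced path on four vertices. A graph-labelled tree $(T,\mathcal{F})$: a tree $T$ whose internal vertices (nodes) $v$ of degree $k$ carry a graph $G_v$ on $k$ marker vertices and a bijection $\rho_v$ from tree-edges at $v$ to $V(G_v)$; for a leaf $l$, a node or leaf $u\ne l$ is $l$-accessible if for consecutive tree-edges $e=wv,e'=vw'$ on the $l,u$-path, $\rho_v(e)\rho_v(e')\in E(G_v)$; the accessibility graph has the leaves as vertices, $x,y$ adjacent iff $y$ is $x$-accessible. A split of $H$ is a bipartition $(V_1,V_2)$ of $V(H)$, $|V_i|\ge 2$, such that every vertex of $V_2$ with a neighbour in $V_1$ is adjacent to every vertex of $V_1$ with a neighbour in $V_2$; prime = no split; degenerate = clique or star ($K_{1,m}$, with centre the universal vertex). Reduced: all nodes of degree $\ge3$, no two adjacent clique nodes, no adjacent star nodes $u,v$ with $\rho_u(uv)$ the centre of $G_u$ and $\rho_v(uv)$ an extremity of $G_v$. The split tree $ST(G)$ is the unique reduced graph-labelled tree with accessibility graph $G$ whose labels are prime or degenerate. Modular graph-labelled tree: let $MD(G)$ be Gallai's canonical modular decomposition tree of $G$ (leaves $V(G)$, each internal node $u$ labelled by the quotient graph $G/\mathcal{P}_u$ of the partition into the leaf sets of its children, series/parallel nodes labelled by cliques/stables). The tree $T$ is the tree underlying $MD(G)$, except that if the root has exactly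 two children one root-incident edge is contracted. Each non-root node $u$ of $MD(G)$ gets label $G/\mathcal{P}_u$ plus an extra universal marker vertex mapped to the edge from $u$ to its parent; the root (if not contracted) gets label $G/\mathcal{P}_{root}$, markers mapped to the child edges. *)

(* Defs.v *)
From mathcomp Require Import all_boot.

Set Implicit Arguments.
Unset Strict Implicit.
Unset Printing Implicit Defensive.

(** A finite simple graph is a symmetric irreflexive [e : rel V], [V : finType].
    The labels of a graph-labelled tree are graphs on a finite set [S] of
    vertices, with edge relation [e] only considered inside [S]. *)

Section Graphs.
Variables (V : finType).
Implicit Types (e : rel V) (S A B : {set V}).

Definition connected_graph e : Prop := 0 < #|V| /\ forall x y, connect e x y.

Definition cograph e : Prop :=
  ~ exists a b c d, [/\ uniq [:: a; b; c; d], [&& e a b, e b c & e c d]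
                      & [&& ~~ e a c, ~~ e b d & ~~ e a d]].

Definition is_tree e : Prop :=
  [/\ symmetric e, irreflexive e, connected_graph e
    & forall c : seq V, 2 < size c -> ~ ucycle e c].

Definition simple_on S e : Prop :=
  {in S, forall x, ~~ e x x} /\ {in S &, forall x y, e x y = e y x}.

Definition split_on S e A B : Prop :=
  [/\ A :|: B = S, [disjoint A & B], 2 <= #|A|, 2 <= #|B|
    & forall a b, a \in A -> b \in B ->
        (exists2 b', b' \in B & e a b') -> (exists2 a', a' \in A & e a' b) ->
        e a b].

Definition prime_on S e : Prop := forall A B, ~ split_on S e A B.

Definition clique_on S e : Prop := {in S &, forall x y, e x y = (x != y)}.

(* [S] induces K_{1,m}, m >= 1, with centre [c]. *)
Definition star_on S e (c : V) : Prop :=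
  [/\ c \in S, 2 <= #|S|
    & {in S &, forall x y, e x y = (x != y) && ((x == c) || (y == c))}].

Definition clique_or_star_on S e : Prop :=
  clique_on S e \/ exists c, star_on S e c.

End Graphs.

(** Data of a graph-labelled tree whose leaves are named by [V]. The tree-edge
    [vw] is represented, as an edge at [v], by its other end [w]: thus
    [rho v w] is the image of [vw] under rho_v, and is meaningful only when
    [v] is a node adjacent to [w]. All markers live in one type [marker];
    the label of [v] is the graph with vertex set [lverts v] and edges
    [ledge v]. The axioms are in [is_glt]. *)
Record glt (V : finType) := Glt {
  tvertex : finType;
  tedge : rel tvertex;
  tleaf : V -> tvertex;
  marker : finType;
  lverts : tvertex -> {set marker};
  ledge : tvertex -> rel marker;
  rho : tvertex -> tvertex -> marker }.

Section GraphLabelledTrees.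
Variables (V : finType).
Implicit Types (T : glt V).

Definition nbh T (v : tvertex T) : {set tvertex T} := [set w | tedge v w].

Definition degree T (v : tvertex T) : nat := #|nbh v|.

(* Internal vertices. The tree with a single vertex has no node: that vertex
   counts as a leaf. *)
Definition is_node T (v : tvertex T) : bool := 1 < degree v.

Definition is_glt T : Prop :=
  [/\ is_tree (@tedge V T),
      injective (@tleaf V T),
      forall v : tvertex T, ~~ is_node v <-> exists x, v = tleaf T x
    & forall v : tvertex T, is_node v ->
        [/\ simple_on (lverts v) (ledge v),
            {in nbh v &, injective (rho v)}
          & rho v @: nbh v = lverts v]].

(* [w :: p] is a vertex sequence; each consecutive triple w, v, w' in it must
   satisfy rho_v(wv) rho_v(vw') \in E(G_v). *)
Fixpoint alternated T (w : tvertex T) (p : seq (tvertex T)) : bool :=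
  match p with
  | v :: ((w' :: _) as p') => ledge v (rho v w) (rho v w') && alternated v p'
  | _ => true
  end.

Definition accessible T (l u : tvertex T) : Prop :=
  u != l /\
  exists p, [/\ path (@tedge V T) l p, uniq (l :: p), last l p = u
              & alternated l p].

Definition accessibility_graph T (e : rel V) : Prop :=
  forall x y, e x y <-> accessible (tleaf T x) (tleaf T y).

Definition reduced T : Prop :=
  [/\ forall v : tvertex T, is_node v -> 3 <= degree v,
      forall u v : tvertex T, is_node u -> is_node v -> tedge u v ->
        ~ (clique_on (lverts u) (ledge u) /\ clique_on (lverts v) (ledge v))
    & forall (u v : tvertex T) (c d : marker T),
        is_node u -> is_node v -> tedge u v ->
        star_on (lverts u) (ledge u) c -> star_on (lverts v) (ledge v) d ->
        ~ (rho u v = c /\ rho v u <> d)].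

Definition is_split_tree (e : rel V) T : Prop :=
  [/\ is_glt T, reduced T, accessibility_graph T e
    & forall v : tvertex T, is_node v ->
        prime_on (lverts v) (ledge v) \/ clique_or_star_on (lverts v) (ledge v)].

Definition clique_star_tree T : Prop :=
  forall v : tvertex T, is_node v -> clique_or_star_on (lverts v) (ledge v).

Definition glt_iso T1 T2 : Prop :=
  exists (f : tvertex T1 -> tvertex T2)
         (g : tvertex T1 -> marker T1 -> marker T2),
    [/\ bijective f,
        forall v w, tedge (f v) (f w) = tedge v w,
        forall x, f (tleaf T1 x) = tleaf T2 x
      & forall v, is_node v ->
          [/\ {in lverts v &, injective (g v)},
              g v @: lverts v = lverts (f v),
              {in lverts v &, forall a b,
                 ledge (f v) (g v a) (g v b) = ledge v a b}
            & {in nbh v, forall w, g v (rho v w) = rho (f v) (f w)}]].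

End GraphLabelledTrees.

Section ModularDecomposition.
Variables (V : finType) (e : rel V).
Implicit Types (M N K : {set V}).

Definition is_module M : bool :=
  [forall x in M, forall y in M, forall z in ~: M, e x z == e y z].

Definition strong_module M : bool :=
  [&& M != set0, is_module M
    & [forall K, is_module K ==>
         [|| [disjoint M & K], M \subset K | K \subset M]]].

(** The tree MD(G): its vertices are the strong modules, ordered by inclusion,
    with root [setT] and leaves the singletons; a strong module [M] is
    identified with the vertex whose descendant leaves form [M]. Hence
    [children M] is also the partition P_M of [M]. *)
Definition children M : {set {set V}} :=
  [set N | [&& strong_module N, N \proper M
             & [forall K, strong_module K ==>
                  ~~ ((N \proper K) && (K \proper M))]]].

Definition quotient_edge M N : bool :=
  (M != N) && [exists x in M, exists y in N, e x y].

Definition contracted_root : bool := #|children setT| == 2.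

(* Contracting an edge between the root and one of its two children removes
   the root and joins its two children by an edge; that edge is then the one
   "to the parent" for both of them. *)
Definition modular_vertex_pred M : bool :=
  strong_module M && ~~ (contracted_root && (M == setT)).

Definition modular_vertex : finType := {M : {set V} | modular_vertex_pred M}.

Definition modular_edge : rel modular_vertex := fun u v =>
  let M := val u in let N := val v in
  [|| N \in children M, M \in children N
    | [&& contracted_root, M != N, M \in children setT & N \in children setT]].

(* [Some N] is the vertex of the quotient graph G/P_M given by the child [N];
   [None] is the extra universal marker, absent at the root. *)
Definition modular_marker : finType := option {set V}.

Definition modular_lverts (u : modular_vertex) : {set modular_marker} :=
  [set m : modular_marker | match m with
           | Some N => N \in children (val u)
           | None => val u != setT
           end].

Definition modular_ledge (u : modular_vertex) : rel modular_marker :=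
  fun m1 m2 => match m1, m2 with
               | Some M, Some N => quotient_edge M N
               | None, None => false
               | _, _ => true
               end.

Definition modular_rho (u v : modular_vertex) : modular_marker :=
  if val v \in children (val u) then Some (val v) else None.

Lemma modular_leaf_subproof (x : V) : modular_vertex_pred [set x].
Proof.
apply/andP; split.
  apply/and3P; split.
  - by apply/set0Pn; exists x; rewrite inE.
  - apply/forall_inP => a /set1P->; apply/forall_inP => b /set1P->.
    by apply/forall_inP.
  - apply/forall_inP => K _; rewrite sub1set disjoints1.
    by case: (x \in K).
apply/negP => /andP[/eqP card2 /eqP setTE].
suff children0 : children setT = set0 by rewrite children0 cards0 in card2.
apply/setP => N; rewrite !inE -setTE.
apply/negP => /and3P[/and3P[N0 _ _] /properP[sN [y /set1P->]] + _].
case/set0Pn: N0 => z zN; have /set1P zx := subsetP sN z zN.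
by rewrite -zx zN.
Qed.

Definition modular_leaf (x : V) : modular_vertex :=
  exist modular_vertex_pred [set x] (modular_leaf_subproof x).

Definition modular_glt : glt V :=
  @Glt V modular_vertex modular_edge modular_leaf modular_marker
    modular_lverts modular_ledge modular_rho.

End ModularDecomposition.

(* Main.v *)
Require Import Defs.
From mathcomp Require Import all_boot.

Set Implicit Arguments.
Unset Strict Implicit.
Unset Printing Implicit Defensive.

(** Each tree-edge vw of ST(G) cuts the leaves into two sides, and the edges of G
    between them form a complete bipartite graph on the accessible leaves. If G is
    a cograph, the leaves of one of the two sides are all accessible (otherwise an
    induced P4 crosses vw), that is, this side is a module. Orienting vw towards
    such a side roots ST(G), at a clique node or at an edge; the side below a node
    is a strong module because ST(G) is reduced, and all strong modules arise in
    this way, which gives the isomorphism with the modular tree. Prime labels do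
    not occur, since a connected cograph with at least 4 vertices has a split.
    Conversely, an induced P4 meets four distinct children of the least strong
    module containing it, so the label of this module is not a clique or a star. *)

(** * Branches of a tree *)

(** Fullness alone does not orient the tree: every edge at a clique root has a module on both sides.
    The relation [down] breaks such ties by discarding the direction into a clique node. Since two
    clique nodes are never adjacent, some direction always survives. Both survive only when neither
    end is a clique node, and such an edge is the trace of a root with two children, which the
    modular tree contracts.

    Labels are not handled marker by marker. Adjacency at a node is read off the graph through
    [sadj], and a leaf with a neighbour across its tree-edge represents that edge, so every label is
    an induced subgraph of [e]. The complement of a P4 is again a P4, which lets joins and disjoint
    unions share one argument with a Boolean colour. *)

Section Branches.
Variables (W : finType) (t : rel W).
Hypothesis t_tree : is_tree t.

Let t_sym : symmetric t. Proof. by case: t_tree. Qed.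
Let t_irr : irreflexive t. Proof. by case: t_tree. Qed.
Let t_conn x y : connect t x y. Proof. by case: t_tree => _ _ []. Qed.

Definition avoid (v : W) : rel W := [rel a b | [&& t a b, a != v & b != v]].

(** When [t v w] holds, deleting the vertex [v] or only the edge [vw] leaves [w] in the same
    component, so this is one shore of the edge and [branch w v] is the other. *)
Definition branch (v w : W) : {set W} := [set u | connect (avoid v) w u].

Lemma avoid_sym v : symmetric (avoid v).
Proof. by move=> a b; rewrite /avoid /= t_sym [(a != v) && _]andbC. Qed.

Lemma avoid_path v w p : w != v ->
  path (avoid v) w p = path t w p && (v \notin p).
Proof.
elim: p w => //= a p IH w wv; rewrite {1}/avoid /= wv inE negb_or /= [v == a]eq_sym.
case: (eqVneq a v) => [->|av]; first by rewrite !andbF.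
by rewrite IH //= andbT andbA.
Qed.

Lemma tree_edge_neq v w : t v w -> w != v.
Proof. by apply: contraTneq => ->; rewrite t_irr. Qed.

Lemma branch_root v w : w \in branch v w.
Proof. by rewrite inE. Qed.

Lemma branchP v w u : t v w ->
  reflect (exists p, [/\ path t w p, uniq (v :: w :: p) & last w p = u])
          (u \in branch v w).
Proof.
move=> tvw; have wv := tree_edge_neq tvw; rewrite inE.
apply: (iffP connectP) => [[p pp ->]|[p [pp /= /andP[vp up] <-]]].
  case/shortenP: pp => p' pp' up' _; exists p'.
  move: pp'; rewrite avoid_path // => /andP[-> vp'].
  by rewrite cons_uniq up' inE eq_sym (negPf wv) vp'.
exists p => //; rewrite avoid_path // pp.
by apply: contra vp; rewrite inE => ->; rewrite orbT.
Qed.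

Lemma branch_avoid v w : t v w -> v \notin branch v w.
Proof.
move=> tvw; apply/branchP => // -[p [_ /andP[+ _] lp]].
by rewrite -{1}lp mem_last.
Qed.

(** A path from [w] to [w'] avoiding [v] would close into a cycle through [v]. *)
Lemma branch_eq v w w' u : t v w -> t v w' ->
  u \in branch v w -> u \in branch v w' -> w = w'.
Proof.
move=> tvw tvw' uw uw'.
have : w' \in branch v w.
  move: uw uw'; rewrite !inE => uw.
  by rewrite (sym_connect_sym (avoid_sym v)); exact: connect_trans.
case/branchP => // -[|a p] [pp up lp]; first exact: lp.
have [_ _ _ acyc] := t_tree.
case: (acyc [:: v, w, a & p]) => //.
rewrite /ucycle up andbT /= rcons_path tvw.
by move: pp lp => /= /andP[-> ->] ->; rewrite t_sym.
Qed.

Lemma branch_cover v u : u != v -> exists2 w, t v w & u \in branch v w.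
Proof.
move=> uv; have /connectP[p0 pp0 lp0] := t_conn v u.
case/shortenP: pp0 lp0 => [[|w p]] /= pp up _ lp; first by rewrite lp eqxx in uv.
case/andP: pp => tvw pp; exists w => //; apply/branchP => //; exists p; split=> //.
Qed.

Lemma branch_path v w p x : t v w -> path t w p -> v \notin p ->
  x \in w :: p -> x \in branch v w.
Proof.
move=> tvw pp vp xp; have wv := tree_edge_neq tvw.
rewrite inE; apply: (path_connect (p := p)) => //.
by rewrite avoid_path // pp.
Qed.

Lemma branch_inner v w z : t v w -> t w z -> z != v -> branch w z \subset branch v w.
Proof.
move=> tvw twz zv; apply/subsetP=> u /branchP-/(_ twz)[p [pp up lp]].
have twv : t w v by rewrite t_sym.
have vp : v \notin z :: p.
  apply/negP => vp; case/negP: zv; apply/eqP.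
  apply: (@branch_eq w z v v) => //; last exact: branch_root.
  apply: branch_path pp _ vp => //; case/andP: up.
  by rewrite inE negb_or => /andP[].
apply: (@branch_path _ _ (z :: p)) => //=; first by rewrite twz.
by rewrite -lp inE mem_last orbT.
Qed.

Lemma branch_next v w u : t v w -> u \in branch v w -> u != w ->
  exists2 z, t w z && (z != v) & u \in branch w z.
Proof.
move=> tvw /branchP-/(_ tvw)[[|z p] /= [pp up lp]] uw; first by rewrite lp eqxx in uw.
case/andP: pp => twz pp; exists z.
  by case/andP: up => + _; rewrite twz !inE !negb_or (eq_sym z) => /and3P[].
apply/branchP => //; exists p; split=> //.
by case/andP: up.
Qed.

Lemma branch_compl v w : t v w -> ~: branch v w = branch w v.
Proof.
move=> tvw; have twv : t w v by rewrite t_sym.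
apply/setP=> u; rewrite inE; apply/idP/idP => [un|uw].
  case: (eqVneq u v) => [->|uv]; first exact: branch_root.
  have [z tvz uz] := branch_cover uv.
  have zw : z != w by apply: contraNneq un => <-.
  exact: (subsetP (branch_inner twv tvz zw)).
apply/negP=> u1; case: (eqVneq u v) => [uv|uv].
  by rewrite uv (negPf (branch_avoid tvw)) in u1.
have [z /andP[tvz zw] uz] := branch_next twv uw uv.
by rewrite (branch_eq tvz tvw uz u1) eqxx in zw.
Qed.

Lemma branch_decr v w z : t v w -> t w z -> z != v -> branch w z \proper branch v w.
Proof.
move=> tvw twz zv; apply/properP; split; first exact: branch_inner.
by exists w; [exact: branch_root | exact: branch_avoid].
Qed.

(** The edges [wz] and [w'z'] point at each other. A path leaving [w'] without using [z'] cannot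
    reach [w], so it stays beyond [wz]. *)
Lemma branch_facing w z w' z' : t w z -> t w' z' ->
  w' \in branch w z -> w \in branch w' z' -> branch z' w' \subset branch w z.
Proof.
move=> twz twz' w'z wz'; have tzw' : t z' w' by rewrite t_sym.
apply/subsetP=> u /branchP-/(_ tzw')[p [pp up lp]].
have zp : z' \notin w' :: p by case/andP: up.
have wp : w \notin w' :: p.
  apply/negP => wp; have : w \in branch z' w'.
    apply: branch_path pp _ wp => //.
    by move: zp; rewrite inE negb_or => /andP[].
  by rewrite -branch_compl // inE wz'.
move: w'z; rewrite !inE => w'z; apply: connect_trans w'z _.
apply/connectP; exists p => //; rewrite avoid_path ?pp.
  by move: wp; rewrite inE negb_or => /andP[].
by move: wp; rewrite inE negb_or eq_sym => /andP[].
Qed.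

End Branches.

(** * Sides of a tree-edge and accessibility *)

Section Sides.
Variables (V : finType) (e : rel V).
Hypotheses (e_sym : symmetric e) (e_conn : connected_graph e).
Variable T : glt V.
Hypotheses (T_glt : is_glt T) (T_acc : accessibility_graph T e).

Local Notation t := (@tedge V T).
Local Notation leaf := (@tleaf V T).
Local Notation br := (branch t).

Let t_tree : is_tree t. Proof. by case: T_glt. Qed.
Let t_sym : symmetric t. Proof. by case: t_tree. Qed.
Let t_irr : irreflexive t. Proof. by case: t_tree. Qed.
Let leaf_inj : injective leaf. Proof. by case: T_glt. Qed.

Definition side (v w : tvertex T) : {set V} := [set x | leaf x \in br v w].

Lemma in_side v w x : (x \in side v w) = (leaf x \in br v w).
Proof. by rewrite [LHS]inE. Qed.

Lemma leaf_not_node x : is_node (leaf x) = false.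
Proof. by apply/negbTE; case: T_glt => _ _ /(_ (leaf x))[_ +] _; apply; exists x. Qed.

Lemma node_or_leaf v : is_node v \/ exists x, v = leaf x.
Proof.
case nv: (is_node v); first by left.
by right; case: T_glt => _ _ /(_ v)[+ _] _; apply; rewrite nv.
Qed.

Lemma leaf_nbr x v w : t (leaf x) v -> t (leaf x) w -> v = w.
Proof.
move=> tv tw; apply/eqP; apply: contraFT (leaf_not_node x) => vw.
by rewrite /is_node /degree (cardsD1 v) (cardsD1 w) !inE tv tw eq_sym vw !add1n.
Qed.

Lemma node_nbr v w : is_node v -> exists2 z, t v z & z != w.
Proof.
rewrite /is_node /degree => dv; have : 0 < #|nbh v :\ w|.
  by move: dv; rewrite (cardsD1 w); case: (_ \in _); rewrite ?add1n ?add0n // => /ltnW.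
by case/card_gt0P=> z; rewrite !inE => /andP[zw tvz]; exists z.
Qed.

Lemma side_leaf v x : t v (leaf x) -> side v (leaf x) = [set x].
Proof.
move=> tvx; apply/setP=> y; rewrite in_set1 in_side; apply/idP/eqP => [yx|->]; last exact: branch_root.
apply/eqP/contraT => yx'.
have [|z /andP[txz zv] _] := branch_next t_tree tvx yx.
  by rewrite (inj_eq leaf_inj).
by rewrite (@leaf_nbr x z v) ?eqxx // t_sym in zv.
Qed.

Lemma side_compl v w : t v w -> ~: side v w = side w v.
Proof. by move=> tvw; apply/setP=> x; rewrite in_setC !in_side -(branch_compl t_tree tvw) in_setC. Qed.

Lemma side_inner v w z : t v w -> t w z -> z != v -> side w z \subset side v w.
Proof.
move=> tvw twz zv; apply/subsetP=> x; rewrite !in_side.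
exact: (subsetP (branch_inner t_tree tvw twz zv)).
Qed.

Lemma side_neq0 v w : t v w -> exists x, x \in side v w.
Proof.
move: {2}(#|br v w|) (leqnn #|br v w|) => n.
elim: n v w => [|n IH] v w.
  by rewrite leqn0 cards_eq0 => /eqP b0; have := branch_root t v w; rewrite b0 inE.
move=> bn tvw; have [nw|[x wx]] := node_or_leaf w; last first.
  by exists x; rewrite in_side -wx branch_root.
have [z twz zv] := node_nbr v nw.
have [|x xz] := IH w z _ twz.
  by rewrite -ltnS; apply: leq_trans bn; apply: proper_card; exact: branch_decr.
by exists x; apply: (subsetP (side_inner tvw twz zv)).
Qed.

Lemma side_next v w x : t v w -> is_node w -> x \in side v w ->
  exists2 z, t w z && (z != v) & x \in side w z.
Proof.
move=> tvw nw; rewrite in_side => xw.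
have [|z tz xz] := branch_next t_tree tvw xw.
  by apply: contraTneq nw => <-; rewrite leaf_not_node.
by exists z; rewrite ?in_side.
Qed.

Lemma side_cover v x : is_node v -> exists2 w, t v w & x \in side v w.
Proof.
move=> nv; have [|w tvw xw] := branch_cover t_tree (v := v) (u := leaf x).
  by apply: contraTneq nv => <-; rewrite leaf_not_node.
by exists w; rewrite ?in_side.
Qed.

Lemma side_eq v w w' x : t v w -> t v w' -> x \in side v w -> x \in side v w' -> w = w'.
Proof. by rewrite !in_side => ? ?; exact: branch_eq. Qed.

Lemma side_disjoint v w w' x : t v w -> t v w' -> w != w' ->
  x \in side v w -> x \notin side v w'.
Proof. by move=> tw tw' ww' xw; apply: contra_neqN ww' => xw'; exact: side_eq xw xw'. Qed.

Lemma side_opp v w w' x : t v w -> t v w' -> w != w' -> x \in side v w -> x \in side w' v.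
Proof.
by move=> tw tw' ww' xw; rewrite -side_compl // in_setC; exact: side_disjoint ww' xw.
Qed.

Lemma rho_lverts v w : is_node v -> t v w -> rho v w \in lverts v.
Proof.
move=> nv tvw; case: T_glt => _ _ _ /(_ v nv)[_ _ <-].
by apply: imset_f; rewrite inE.
Qed.

Lemma ledge_irr v w : is_node v -> t v w -> ledge v (rho v w) (rho v w) = false.
Proof.
move=> nv tvw; apply/negbTE; case: T_glt => _ _ _ /(_ v nv)[[+ _] _ _]; apply.
exact: rho_lverts.
Qed.

Lemma ledge_sym v w w' : is_node v -> t v w -> t v w' ->
  ledge v (rho v w) (rho v w') = ledge v (rho v w') (rho v w).
Proof.
move=> nv tvw tvw'; case: T_glt => _ _ _ /(_ v nv)[[_ +] _ _]; apply;
  exact: rho_lverts.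
Qed.

(** Alternation is required from [w] onwards and nothing is required at [v], so accessibility is
    measured from the edge [vw], whether [v] is a leaf or a node. *)
Definition access (v w u : tvertex T) : Prop :=
  exists p, [/\ path t v (w :: p), uniq [:: v, w & p], last w p = u
              & alternated v (w :: p)].

Lemma access_refl v w : t v w -> access v w w.
Proof.
move=> tvw; exists [::]; rewrite /= tvw inE andbT; split=> //.
by rewrite eq_sym (tree_edge_neq t_tree tvw).
Qed.

Lemma access_next v w z u : t v w -> t w z -> z != v -> u \in br w z ->
  access v w u <-> ledge w (rho w v) (rho w z) /\ access w z u.
Proof.
move=> tvw twz zv uz; split=> [[[|z' p] [pp up lp ap]]|[lvz [p [pp up lp ap]]]].
- by case/negP: (branch_avoid t_tree twz); rewrite {1}(lp : w = u).
- have zz' : z = z'.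
    have twz' : t w z' by case/and3P: pp.
    apply: (branch_eq t_tree twz twz' uz); apply/branchP => //.
    exists p; split=> //; first by case/and3P: pp.
    by case/andP: up.
  case/andP: ap; rewrite zz' => -> ap; split=> //; exists p; split=> //.
    by case/andP: pp.
  by case/andP: up.
- exists (z :: p); split=> //; first by rewrite /= tvw -/(path t w (z :: p)).
    rewrite cons_uniq up andbT; apply/negP => vp.
    have: v \in br w z.
      apply: (@branch_path _ _ t_tree w z p) => //; first by case/andP: pp.
        by case/andP: up; rewrite inE negb_or => /andP[].
      by move: vp; rewrite inE eq_sym (negPf (tree_edge_neq t_tree tvw)).
    have twv : t w v by rewrite t_sym.
    move=> vz; case/eqP: zv; apply: (branch_eq t_tree twz twv vz); exact: branch_root.
  by rewrite /= lvz.
Qed.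

(** The edge is moved towards [leaf x]. Each step passes the alternation condition at [w] from the
    path ending in [x] to the path ending in [y]; once the edge is incident to [leaf x], what
    remains is the definition of accessibility. *)
Lemma crossing v w x y : t v w -> x \in side v w -> y \in side w v ->
  e x y <-> access v w (leaf x) /\ access w v (leaf y).
Proof.
rewrite !in_side; move: {2}(#|br v w|) (leqnn #|br v w|) => n.
elim: n v w => [|n IH] v w.
  by rewrite leqn0 cards_eq0 => /eqP b0; have := branch_root t v w; rewrite b0 inE.
move=> bn tvw xw yv; have twv : t w v by rewrite t_sym.
have [wx|wx] := eqVneq (leaf x) w.
  apply: iff_trans (T_acc x y) _; split=> [[yx [[|v' p] [pp up lp ap]]]|[_ [p [pp up lp ap]]]].
  - by rewrite -lp eqxx in yx.
  - rewrite wx; split; first exact: access_refl.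
    have -> : v = v'.
      by apply: (@leaf_nbr x); rewrite wx //; case/andP: pp; rewrite wx.
    by exists p; split=> //; rewrite -wx.
  - split; last by exists (v :: p); split=> //; rewrite wx.
    apply: contraTneq yv => ->; rewrite wx; exact: branch_avoid.
have [z /andP[twz zv] xz] := branch_next t_tree tvw xw wx.
have tzw : t z w by rewrite t_sym.
have wl : is_node w.
  have [//|[x' wx']] := node_or_leaf w; case/eqP: zv.
  by apply: (@leaf_nbr x'); rewrite -wx'.
have vz : v != z by rewrite eq_sym.
have bz : #|br w z| <= n.
  by rewrite -ltnS; apply: leq_trans bn; apply: proper_card; exact: branch_decr.
have yz : leaf y \in br z w by exact: (subsetP (branch_inner t_tree tzw twv vz)).
have [IH1 IH2] := IH w z bz twz xz yz.
have [A1 A2] := access_next tvw twz zv xz; have [B1 B2] := access_next tzw twv vz yv.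
have l_sym := ledge_sym wl twz twv.
split=> [/IH1[wzx /B1[l wvy]]|[/A1[l wzx] wvy]]; first by split=> //; apply: A2; rewrite -l_sym.
by apply: IH2; split=> //; apply: B2; rewrite l_sym.
Qed.

Lemma connected_cut (X : {set V}) x y : x \in X -> y \notin X ->
  exists x' y', [/\ x' \in X, y' \notin X & e x' y'].
Proof.
move=> xX; have /connectP[p pp ->] : connect e x y by case: e_conn.
elim: p x xX pp => /= [|z p IH] x xX; first by rewrite xX.
case/andP=> exz pp; case zX: (z \in X); first exact: IH.
by move=> _; exists x, z; rewrite zX.
Qed.

Lemma crossing_exists v w : t v w ->
  exists x y, [/\ x \in side v w, y \in side w v & e x y].
Proof.
move=> tvw; have twv : t w v by rewrite t_sym.
have [x xw] := side_neq0 tvw; have [y yv] := side_neq0 twv.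
have [|x' [y' [x'w y'w exy]]] := connected_cut xw (y := y).
  by rewrite -in_setC side_compl.
by exists x', y'; split=> //; rewrite -side_compl // in_setC.
Qed.

Lemma crossing_split v w x x' y y' : t v w ->
  x \in side v w -> x' \in side v w -> y \in side w v -> y' \in side w v ->
  e x y -> e x' y' -> e x y'.
Proof.
move=> tvw xw x'w yv y'v /(crossing tvw xw yv)[ax _] /(crossing tvw x'w y'v)[_ ay].
exact/(crossing tvw xw y'v).
Qed.

(* The label at [v] transported to the tree-edges at [v], see [ledge_sadj]. *)
Definition sadj (v w w' : tvertex T) : bool :=
  (w != w') && [exists x in side v w, exists y in side v w', e x y].

Lemma sadjP v w w' : reflect (w != w' /\ exists x y, [/\ x \in side v w, y \in side v w' & e x y])
  (sadj v w w').
Proof.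
apply: (iffP andP) => -[ww' h]; split=> //.
  by case/exists_inP: h => x xw /exists_inP[y yw' exy]; exists x, y.
case: h => x [y [xw yw' exy]]; apply/exists_inP; exists x => //.
by apply/exists_inP; exists y.
Qed.

Lemma sadj_sym v w w' : sadj v w w' = sadj v w' w.
Proof.
by apply/sadjP/sadjP=> -[ww' [x [y [xw yw' exy]]]]; split;
  rewrite 1?eq_sym //; exists y, x; rewrite e_sym.
Qed.

(** Connectedness puts a graph edge across every tree-edge, so each side at [v] has a leaf
    accessible from [v]. Two such leaves on different sides are adjacent exactly when the label
    joins their markers. *)
Lemma ledge_sadj v w w' : is_node v -> t v w -> t v w' ->
  ledge v (rho v w) (rho v w') = sadj v w w'.
Proof.
move=> nv tvw tvw'; have [->|ww'] := eqVneq w w'.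
  by rewrite ledge_irr // /sadj eqxx.
have w'w : w' != w by rewrite eq_sym.
have twv : t w v by rewrite t_sym.
have key x y : x \in side v w -> y \in side v w' ->
    e x y <-> access v w (leaf x) /\ ledge v (rho v w) (rho v w') /\ access v w' (leaf y).
  move=> xw yw'; have yv : y \in side w v by exact: side_opp w'w yw'.
  apply: iff_trans (crossing tvw xw yv) _; apply: and_iff_compat_l.
  by apply: access_next => //; rewrite -in_side.
apply/idP/sadjP => [l|[_ [x [y [xw yw' exy]]]]]; last first.
  by have [_ [? _]] := (key x y xw yw').1 exy.
split=> //.
have [x [x' [xw x'v exx']]] := crossing_exists tvw.
have [y [y' [yw y'v eyy']]] := crossing_exists tvw'.
exists x, y; split=> //; apply/key => //.
by case: ((crossing tvw xw x'v).1 exx'); case: ((crossing tvw' yw y'v).1 eyy').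
Qed.

End Sides.

(** * Uniform cuts of P4-free graphs *)

Section UniformCuts.
Variables (W : finType) (h : rel W).
Implicit Types S A B : {set W}.

Definition p4 a b c d : bool :=
  [&& uniq [:: a; b; c; d], h a b, h b c, h c d, ~~ h a c, ~~ h b d & ~~ h a d].

Definition p4_free S : Prop :=
  forall a b c d, a \in S -> b \in S -> c \in S -> d \in S -> ~~ p4 a b c d.

(** For symmetric [h], colour [false] splits [S] as a disjoint union and colour [true] as a join. *)
Definition uniform_cut S b A : Prop :=
  [/\ A \proper S, A != set0 & forall x y, x \in A -> y \in S :\: A -> h x y = b].

Lemma uniform_cutC S b A : {in S &, symmetric h} ->
  uniform_cut S b A -> uniform_cut S b (S :\: A).
Proof.
move=> h_sym [/properP[sAS [u uS uA]] /set0Pn[a aA] hA]; split.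
- apply/properP; split; first exact: subsetDl.
  by exists a; rewrite ?inE ?aA // (subsetP sAS).
- by apply/set0Pn; exists u; rewrite inE uA.
- move=> x y xSA yS; have /setDP[xS _] := xSA.
  have yA : y \in A by have /setDP[yS' ] := yS; rewrite inE yS' andbT negbK.
  by rewrite h_sym ?hA // (subsetP sAS).
Qed.

(** If [v] has colour [b] to everything outside [A], it joins [A]. Otherwise the part of [A] with
    colour [b] to [v] is itself a cut, because a pair inside [A] violating this completes a P4 with
    [v] and a vertex [b1] outside [A]. *)
Lemma uniform_cut_extend S b v A u :
  {in S &, symmetric h} -> p4_free S ->
  v \in S -> uniform_cut (S :\ v) b A -> u \in A -> h v u = b ->
  exists b' A', uniform_cut S b' A'.
Proof.
move=> h_sym S4 vS [/properP[sA [w wS wA]] _ hA] uA hvu.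
have sAS x : x \in A -> x \in S by move=> /(subsetP sA)/setD1P[].
have vA : v \notin A by apply/negP => /(subsetP sA); rewrite !inE eqxx.
have /setD1P[wv wS'] := wS.
have nbhd x : x \in S -> x \notin A -> x != v -> x \in (S :\ v) :\: A.
  by rewrite !inE => -> -> ->.
have [/exists_inP[b1 /setDP[b1S b1A] hb1]|noB] :=
    boolP [exists y in (S :\ v) :\: A, h v y != b]; last first.
  exists b, (v |: A); split.
  - apply/properP; split; first by rewrite subUset sub1set vS; apply/subsetP.
    by exists w; rewrite // !inE negb_or wv.
  - by apply/set0Pn; exists v; rewrite !inE eqxx.
  - move=> x y xvA /setDP[yS]; rewrite in_setU1 negb_or => /andP[yv yA].
    have yn : y \in (S :\ v) :\: A by exact: nbhd.
    case/setU1P: xvA => [->|xA]; last exact: hA.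
    by apply/eqP; apply: contraR noB => hvy; apply/exists_inP; exists y.
pose A0 := [set x in A | h v x == b].
have [/existsP[a0 /existsP[a1 /and5P[a0A ha0 a1A ha1 ha01]]]|noA] :=
    boolP [exists a0, exists a1, [&& a0 \in A, h v a0 == b, a1 \in A, h v a1 != b & h a0 a1 != b]].
  have /setD1P[b1v b1S'] := b1S.
  have b1n : b1 \in (S :\ v) :\: A by rewrite inE b1A.
  have E x y : x \in S -> y \in S -> h x y = h y x by move=> *; exact: h_sym.
  have [a0S a1S] := (sAS a0 a0A, sAS a1 a1A).
  have uq : [&& a0 != a1, a0 != v, a1 != v, a0 != b1, a1 != b1 & v != b1].
    rewrite [v == b1]eq_sym b1v andbT; apply/and5P; split;
      by [apply: contraNneq ha1 => <- | apply: contraNneq vA => <- | apply: contraNneq b1A => <-].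
  have [h0 h1] := (hA a0 b1 a0A b1n, hA a1 b1 a1A b1n).
  (* In colour [b] the path is [v], [a0], [b1], [a1]. For [b = false] the graph itself contains the
     complementary path [a0], [a1], [v], [b1]. *)
  move: ha0 ha1 ha01 hb1 h0 h1 {hvu hA}; case: (b) => /eqP ha0 ha1 ha01 hb1 h0 h1.
    case/negP: (S4 v a0 b1 a1 vS a0S b1S' a1S).
    rewrite /p4 /= !inE !negb_or ha0 h0 (E b1) // h1 [v == a0]eq_sym [v == a1]eq_sym [b1 == a1]eq_sym.
    move: ha1 hb1 ha01; rewrite !eqb_id => -> -> ->.
    by case/and5P: uq => -> -> -> -> /andP[-> ->].
  case/negP: (S4 a0 a1 v b1 a0S a1S vS b1S').
  rewrite /p4 /= !inE !negb_or (E a1 v) // (E a0 v) // ha0 h0 h1.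
  move: ha1 hb1 ha01; rewrite !eqbF_neg !negbK => -> -> ->.
  by case/and5P: uq => -> -> -> -> /andP[-> ->].
exists b, A0; split.
- apply/properP; split; first by apply/subsetP=> x; rewrite inE => /andP[/sAS].
  by exists v => //; rewrite inE (negPf vA).
- by apply/set0Pn; exists u; rewrite inE uA hvu eqxx.
- move=> x y; rewrite inE => /andP[xA /eqP hvx] /setDP[yS].
  case: (eqVneq y v) => [->|yv]; first by rewrite h_sym // sAS.
  rewrite inE; case yA: (y \in A) => /= hvy; last by apply: hA => //; apply: nbhd; rewrite ?yA.
  apply/eqP; apply: contraR noA => hxy.
  by apply/existsP; exists x; apply/existsP; exists y; rewrite xA yA hvx eqxx hvy.
Qed.

(** The classical fact that a P4-free graph with at least two vertices, or its complement, is
    disconnected. A vertex [v] is removed: if it has the colour of the smaller cut to some vertex,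
    that cut extends; otherwise [v] has the opposite colour to all others and is cut off alone. *)
Lemma uniform_cut_exists S : {in S &, symmetric h} -> p4_free S -> 1 < #|S| ->
  exists b A, uniform_cut S b A.
Proof.
move: {2}(#|S|) (leqnn #|S|) => n; elim: n S => [|n IH] S; first by rewrite leqn0 => /eqP->.
move=> Sn h_sym S4 S2; have [v vS] : exists v, v \in S by apply/card_gt0P; exact: ltnW.
have sub : {subset S :\ v <= S} by move=> x /setD1P[].
have Sv : #|S| = #|S :\ v|.+1 by rewrite (cardsD1 v) vS.
have /card_gt0P[u uS] : 0 < #|S :\ v| by rewrite -ltnS -Sv.
have [Sv2|Sv2] := ltnP 1 #|S :\ v|; last first.
  exists (h v u), [set v]; split.
  - apply/properP; split; first by rewrite sub1set.
    by have /setD1P[uv uS'] := uS; exists u; rewrite // inE.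
  - by apply/set0Pn; exists v; rewrite inE.
  - move=> x y /set1P-> yS; congr (h v _).
    by apply: (card_le1_eqP Sv2).
have [|||//|b [A cutA]] := IH (S :\ v).
- by rewrite -ltnS -Sv.
- by move=> x y xS yS; apply: h_sym; apply: sub.
- by move=> a b c d *; apply: S4; apply: sub.
have cutB : uniform_cut (S :\ v) b (S :\ v :\: A).
  by apply: uniform_cutC cutA => x y xS yS; apply: h_sym; apply: sub.
have [/exists_inP[x xS /eqP hvx]|none] := boolP [exists x in S :\ v, h v x == b].
  have [xA|xA] := boolP (x \in A); first exact: uniform_cut_extend cutA xA hvx.
  by apply: uniform_cut_extend cutB _ hvx; rewrite // inE xA.
exists (~~ b), [set v]; split.
- apply/properP; split; first by rewrite sub1set.
  by have /setD1P[uv uS'] := uS; exists u; rewrite // inE.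
- by apply/set0Pn; exists v; rewrite inE.
- move=> x y /set1P-> yS; move: none; rewrite negb_exists_in => /forall_inP/(_ y yS).
  by case: (h v y); case: (b).
Qed.

(* The cut given by [uniform_cut_exists] is a split as soon as both sides have
   two elements. Otherwise one side is a universal vertex [a], and a uniform cut
   of the other vertices, with [a] added to a side, is a split unless |S| = 3. *)
Lemma prime_clique_or_star S :
  {in S, irreflexive h} -> {in S &, symmetric h} -> p4_free S -> 2 < #|S| ->
  (forall A, ~ uniform_cut S false A) -> prime_on S h -> clique_or_star_on S h.
Proof.
move=> h_irr h_sym S4 S3 conn prime.
have [a aS ha] : exists2 a, a \in S & forall x, x \in S :\ a -> h a x.
  have [[] [A cutA]] := uniform_cut_exists h_sym S4 (ltnW S3); last by case: (conn A).
  have single X : uniform_cut S true X -> #|X| <= 1 ->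
      exists2 a, a \in S & forall x, x \in S :\ a -> h a x.
    case=> sX X0 hX X1; have /cards1P[a Xa] : #|X| == 1.
      by rewrite eqn_leq X1 card_gt0.
    exists a => [|x xS]; last by apply: hX; rewrite Xa ?set11.
    by apply: (subsetP (proper_sub sX)); rewrite Xa inE.
  have [/single|A2] := leqP #|A| 1; first exact.
  have [/(single _ (uniform_cutC h_sym cutA))//|B2] := leqP #|S :\: A| 1.
  case: (prime A (S :\: A)); case: cutA => /proper_sub sA _ hA; split=> //.
  - by rewrite -[RHS](setID S A) (setIidPr sA).
  - by rewrite disjoints_subset setCD subsetUr.
  - by move=> x y xA yA _ _; rewrite hA.
pose B := S :\ a.
have sBS : {subset B <= S} by move=> x /setD1P[].
have SB : #|S| = #|B|.+1 by rewrite (cardsD1 a) aS.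
have B2 : 1 < #|B| by rewrite -ltnS -SB.
have hB_sym : {in B &, symmetric h} by move=> x y xB yB; apply: h_sym; apply: sBS.
have [|b [B1 cutB]] := uniform_cut_exists hB_sym _ B2.
  by move=> *; apply: S4; apply: sBS.
have small X : uniform_cut B b X -> #|B :\: X| <= 1.
  case=> /proper_sub sX /set0Pn[x xX] hX; rewrite leqNgt; apply/negP => X2.
  have aX : a \notin X by apply/negP => /(subsetP sX); rewrite !inE eqxx.
  case: (prime (a |: X) (B :\: X)); split=> //.
  - by rewrite -setUA -[in RHS](setD1K aS) -[in RHS](setID (S :\ a) X) (setIidPr sX).
  - rewrite disjoints_subset; apply/subsetP=> y; rewrite !inE.
    by case/orP=> [/eqP->|->]; rewrite ?eqxx ?andbF.
  - by rewrite cardsU1 aX (cardsD1 x) xX.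
  - move=> u y uaX yBX [y' y'BX huy'] _.
    case/setU1P: uaX huy' => [-> _|uX]; first by apply: ha; case/setDP: yBX.
    by rewrite (hX u y' uX y'BX) (hX u y uX yBX).
have cutB' := uniform_cutC hB_sym cutB.
have sB1 : B1 \subset B by case: cutB => /proper_sub.
have BB1 : B :\: (B :\: B1) = B1 by rewrite setDDr setDv set0U (setIidPr sB1).
have /cards1P[y By] : #|B1| == 1.
  by case: cutB => _ n0 _; rewrite eqn_leq card_gt0 n0 -{1}BB1 small.
have /cards1P[z Bz] : #|B :\: B1| == 1.
  by case: cutB' => _ n0 _; rewrite eqn_leq card_gt0 n0 small.
have BE : B = [set y; z] by rewrite -(setID B B1) Bz (setIidPr sB1) By.
have hyz : h y z = b.
  by case: cutB => _ _; apply; rewrite ?Bz ?By inE.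
have [yB zB] : y \in B /\ z \in B by rewrite BE !inE !eqxx orbT.
have [/setD1P[ya yS] /setD1P[za zS]] := (yB, zB).
have yz : y != z.
  have /setDP[_] : z \in B :\: B1 by rewrite Bz inE.
  by rewrite By inE eq_sym.
have SE : S = [set a; y; z] by rewrite -(setD1K aS) -/B BE setUA.
have [hay haz] := (ha y yB, ha z zB).
have E u w : u \in S -> w \in S -> h u w = h w u by move=> *; exact: h_sym.
have haa := h_irr a aS; have hyy := h_irr y yS; have hzz := h_irr z zS.
have hya : h y a by rewrite E.
have hza : h z a by rewrite E.
have hzy : h z y = b by rewrite E.
(* With [a] universal among three vertices, the colour of the pair [y], [z] decides between a
   triangle and a star centred at [a]. *)
case: (b) hyz hzy => hyz hzy; [left|right; exists a; split=> //; first exact: ltnW];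
  move=> u w; rewrite SE !inE -!orbA => /or3P[]/eqP-> /or3P[]/eqP->;
  rewrite ?eqxx ?haa ?hyy ?hzz ?hay ?haz ?hya ?hza ?hyz ?hzy //=;
  rewrite ?[a == y]eq_sym ?[a == z]eq_sym ?[z == y]eq_sym ?(negPf ya) ?(negPf za) ?(negPf yz) //.
Qed.
End UniformCuts.

(** * Modules *)

Section Modules.
Variables (V : finType) (e : rel V).
Implicit Types (M K : {set V}).

Lemma moduleP M : reflect
  (forall x y u, x \in M -> y \in M -> u \notin M -> e x u = e y u) (is_module e M).
Proof.
apply: (iffP forall_inP) => h x.
  move=> y u xM yM uM; move: (h x xM) => /forall_inP/(_ y yM)/forall_inP/(_ u).
  by rewrite inE => /(_ uM)/eqP.
move=> xM; apply/forall_inP=> y yM; apply/forall_inP=> u; rewrite inE => uM.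
by apply/eqP; exact: h.
Qed.

Lemma strong_moduleP M : reflect
  [/\ M != set0, is_module e M
    & forall K, is_module e K -> [|| [disjoint M & K], M \subset K | K \subset M]]
  (strong_module e M).
Proof.
apply: (iffP and3P) => -[M0 mM hM]; split=> //; last exact/forall_inP.
by move=> K; move/forall_inP: hM; apply.
Qed.

(** A vertex of [K :\: M] sees [M] uniformly and a vertex of [M :\: K] sees [K] uniformly, so one
    colour propagates. In particular [K] cuts [M] uniformly, which is how an overlapping module is
    refuted later. *)
Lemma overlapping_modules M K : symmetric e -> is_module e M -> is_module e K ->
  ~~ [|| [disjoint M & K], M \subset K | K \subset M] ->
  exists b k c, [/\ k \in K :\: M, c \in M :&: K,
    forall p q, p \in M :&: K -> q \in M :\: K -> e p q = b
    & forall k' m, k' \in K :\: M -> m \in M -> e k' m = b].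
Proof.
move=> e_sym /moduleP mM /moduleP mK; rewrite !negb_or -setI_eq0.
case/and3P=> /set0Pn[c cMK] /subsetPn[m mM' mK'] /subsetPn[k kK kM].
have kKM : k \in K :\: M by rewrite inE kM.
have /setIP[cM cK] := cMK.
have kb k' m' : k' \in K :\: M -> m' \in M -> e k' m' = e k m.
  case/setDP=> k'K k'M m'M; rewrite e_sym (mM m' m k') // e_sym.
  exact: mK.
exists (e k m), k, c; split=> //.
move=> p q /setIP[pM pK] /setDP[qM qK]; rewrite (mK p k q) //.
by rewrite e_sym (mM q m) // e_sym.
Qed.

End Modules.

Section Children.
Variables (V : finType) (e : rel V).
Hypothesis e_sym : symmetric e.
Implicit Types (M N K : {set V}).

Lemma childrenP M N : N \in children e M ->
  [/\ strong_module e N, N \proper M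
    & forall K, strong_module e K -> N \proper K -> K \proper M -> False].
Proof.
rewrite inE => /and3P[sN pN /forall_inP mN]; split=> // K sK NK KM.
by have := mN K sK; rewrite NK KM.
Qed.

Lemma children_cover M x : strong_module e M -> x \in M -> 1 < #|M| ->
  exists2 N, N \in children e M & x \in N.
Proof.
move=> sM xM M1.
pose P N := [&& strong_module e N, N \proper M & x \in N].
have P0 : P [set x].
  rewrite /P properEcard sub1set xM cards1 M1 inE eqxx.
  by case/andP: (modular_leaf_subproof e x) => ->.
case: (@arg_maxnP _ [set x] P (fun N => #|N|) P0) => N /and3P[sN pN xN] maxN.
exists N => //; rewrite inE sN pN; apply/forall_inP=> K sK; apply/negP=> /andP[NK KM].
have := maxN K; rewrite /P sK KM (subsetP (proper_sub NK)) // => /(_ isT).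
by rewrite /= leqNgt proper_card.
Qed.

Lemma children_eq M N K x : N \in children e M -> K \in children e M ->
  x \in N -> x \in K -> N = K.
Proof.
move=> /childrenP[sN pN mN] /childrenP[sK pK mK] xN xK.
have /strong_moduleP[_ _ hN] := sN; have /strong_moduleP[_ modK _] := sK.
apply/eqP/contraT=> ne; case/or3P: (hN K modK) => [|NK|KN].
- by move=> /disjointFr/(_ xN); rewrite xK.
- by case: (mN K sK) => //; rewrite properEneq ne.
- by case: (mK N sN) => //; rewrite properEneq eq_sym ne.
Qed.

Lemma quotient_edge_child M N K x y : N \in children e M -> K \in children e M ->
  N != K -> x \in N -> y \in K -> quotient_edge e N K = e x y.
Proof.
move=> cN cK ne xN yK; rewrite /quotient_edge ne /=.
have [/strong_moduleP[_ /moduleP modN _] _ _] := childrenP cN.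
have [/strong_moduleP[_ /moduleP modK _] _ _] := childrenP cK.
have NK z : z \in K -> z \notin N.
  by move=> zK; apply: contra_neqN ne => zN; exact: (children_eq cN cK zN zK).
have KN z : z \in N -> z \notin K by move=> zN; apply/negP=> /NK/negP.
apply/exists_inP/idP => [[x' x'N /exists_inP[y' y'K]]|exy].
  by rewrite (modN x' x) ?NK // e_sym (modK y' y) ?KN // e_sym.
by exists x => //; apply/exists_inP; exists y.
Qed.

(** A P4 is prime for modules: any two or three of its vertices include a pair that one of the
    others distinguishes. The seven instances of [mN] provide such a pair in every case. *)
Lemma p4_module N a b c d : is_module e N -> p4 e a b c d ->
  1 < (a \in N) + (b \in N) + (c \in N) + (d \in N) ->
  [&& a \in N, b \in N, c \in N & d \in N].
Proof.
move=> /moduleP mN /and5P[_ eab ebc ecd /and3P[/negPf eac /negPf ebd /negPf ead]].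
have eba : e b a by rewrite e_sym.
have ecb : e c b by rewrite e_sym.
have edc : e d c by rewrite e_sym.
have eca : e c a = false by rewrite e_sym.
have edb : e d b = false by rewrite e_sym.
have eda : e d a = false by rewrite e_sym.
case aN: (a \in N); case bN: (b \in N); case cN: (c \in N); case dN: (d \in N) => n2;
  first [by [] | by exfalso; move: n2; compute | first [
    have := mN b c d bN cN (negbT dN)
    | have := mN a b c aN bN (negbT cN)
    | have := mN a d b aN dN (negbT bN)
    | have := mN a c d aN cN (negbT dN)
    | have := mN b c a bN cN (negbT aN)
    | have := mN b d a bN dN (negbT aN)
    | have := mN c d b cN dN (negbT bN)];
    by rewrite ?eab ?ebc ?ecd ?eac ?ebd ?ead ?eba ?ecb ?edc ?eca ?edb ?eda].
Qed.

End Children.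

(** * The split tree of a cograph *)

Section CographLabels.
Variables (V : finType) (e : rel V).
Hypotheses (e_sym : symmetric e) (e_irr : irreflexive e).
Hypotheses (e_conn : connected_graph e) (e_cog : cograph e).
Variable T : glt V.
Hypothesis T_split : is_split_tree e T.
Implicit Types u v w c : tvertex T.

Local Notation t := (@tedge V T).
Local Notation leaf := (@tleaf V T).
Local Notation sd := (@side V T).
Local Notation sa := (@sadj V e T).

Let T_glt : is_glt T. Proof. by case: T_split. Qed.
Let T_acc : accessibility_graph T e. Proof. by case: T_split. Qed.
Let t_tree : is_tree t. Proof. by case: T_glt. Qed.
Let t_sym : symmetric t. Proof. by case: t_tree. Qed.

(** * Labels of the split tree of a cograph *)

Lemma split_tree_degree v : is_node v -> 2 < degree v.
Proof. by case: T_split => _ [+ _ _] _ _; apply. Qed.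

Lemma card_lverts v : is_node v -> #|lverts v| = degree v.
Proof.
by move=> nv; case: T_glt => _ _ _ /(_ v nv)[_ rho_inj <-]; rewrite card_in_imset.
Qed.

Lemma lvertsP v m : is_node v -> m \in lverts v -> exists2 w, t v w & m = rho v w.
Proof.
move=> nv; case: T_glt => _ _ _ /(_ v nv)[_ _ <-] /imsetP[w].
by rewrite inE => tvw ->; exists w.
Qed.

Lemma rho_eq v w w' : is_node v -> t v w -> t v w' -> (rho v w == rho v w') = (w == w').
Proof.
move=> nv tvw tvw'; case: T_glt => _ _ _ /(_ v nv)[_ rho_inj _].
by rewrite (inj_in_eq rho_inj) ?inE.
Qed.

(** A neighbour outside its side makes a leaf accessible from [v], hence a valid representative of
    that side. The split property is applied once at each of the two tree-edges. *)
Lemma sadj_rep v w w' x y x' y' : t v w -> t v w' -> sa v w w' ->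
  x \in sd v w -> x' \notin sd v w -> e x x' ->
  y \in sd v w' -> y' \notin sd v w' -> e y y' -> e x y.
Proof.
move=> tw tw' /sadjP[ww' [x0 [y0 [x0w y0w' exy0]]]] xw x'w exx' yw' y'w' eyy'.
have xx' : x' \in sd w v by rewrite -side_compl // inE.
have yy' : y' \in sd w' v by rewrite -side_compl // inE.
have w'w : w' != w by rewrite eq_sym.
have y0w : y0 \in sd w v by exact: side_opp w'w y0w'.
have x0w' : x0 \in sd w' v by exact: side_opp ww' x0w.
have exy0' : e x y0 := crossing_split T_glt T_acc tw xw x0w xx' y0w exx' exy0.
have xw' : x \in sd w' v by exact: side_opp ww' xw.
rewrite e_sym; apply: (crossing_split T_glt T_acc tw' yw' y0w' yy' xw' eyy').
by rewrite e_sym.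
Qed.

(** One representative leaf per marker realises the label as an induced subgraph of [e]. *)
Lemma sadj_p4 v a b c d : is_node v -> t v a -> t v b -> t v c -> t v d ->
  ~~ p4 (sa v) a b c d.
Proof.
move=> nv ta tb tc td; apply/negP; rewrite /p4.
case/and5P=> uq qab qbc qcd /and3P[qac qbd qad].
have rep w : t v w -> exists x x', [/\ x \in sd v w, x' \notin sd v w & e x x'].
  move=> tw; have [x [x' [xw x'v exx']]] := crossing_exists e_conn T_glt tw.
  by exists x, x'; split=> //; move: x'v; rewrite -side_compl // inE.
have [xa [xa' [a1 a2 a3]]] := rep a ta; have [xb [xb' [b1 b2 b3]]] := rep b tb.
have [xc [xc' [c1 c2 c3]]] := rep c tc; have [xd [xd' [d1 d2 d3]]] := rep d td.
have nsd w w' x y : t v w -> t v w' -> w != w' -> x \in sd v w -> y \in sd v w' -> x != y.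
  by move=> tw tw' ww' xw yw'; apply: contraNneq ww' => xy; apply/eqP;
    apply: (side_eq T_glt tw tw' xw); rewrite xy.
have nq w w' x y : w != w' -> x \in sd v w -> y \in sd v w' -> ~~ sa v w w' -> ~~ e x y.
  by move=> ww' xw yw'; apply: contra => exy; apply/sadjP; split=> //; exists x, y.
move: uq; rewrite /= !inE !negb_or => /and4P[/and3P[ab ac ad] /andP[bc bd] cd _].
case: e_cog; exists xa, xb, xc, xd; split.
- rewrite /= !inE !negb_or (nsd a b xa xb) // (nsd a c xa xc) // (nsd a d xa xd) //.
  by rewrite (nsd b c xb xc) // (nsd b d xb xd) // (nsd c d xc xd).
- by apply/and3P; split; [apply: (sadj_rep ta tb qab a1 a2 a3 b1 b2 b3)
    |apply: (sadj_rep tb tc qbc b1 b2 b3 c1 c2 c3)|apply: (sadj_rep tc td qcd c1 c2 c3 d1 d2 d3)].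
- by apply/and3P; split; [apply: (nq a c)|apply: (nq b d)|apply: (nq a d)].
Qed.

Lemma cograph_label v : is_node v -> clique_or_star_on (lverts v) (ledge v).
Proof.
move=> nv; have [_ _ _ /(_ v nv)[prime|//]] := T_split.
have [[h_irr h_sym] rho_inj rho_im] : [/\ simple_on (lverts v) (ledge v),
    {in nbh v &, injective (rho v)} & rho v @: nbh v = lverts v].
  by case: T_glt => _ _ _ /(_ v nv).
have lq := ledge_sadj e_conn T_glt T_acc nv.
apply: prime_clique_or_star prime => //.
- by move=> m mv; apply/negbTE/h_irr.
- move=> m1 m2 m3 m4 /(lvertsP nv)[w1 t1 ->] /(lvertsP nv)[w2 t2 ->].
  move=> /(lvertsP nv)[w3 t3 ->] /(lvertsP nv)[w4 t4 ->].
  have := sadj_p4 nv t1 t2 t3 t4; apply: contra.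
  by rewrite /p4 /= !inE !rho_eq // !lq.
- by rewrite card_lverts // split_tree_degree.
move=> A [/properP[sA [m' m'v m'A]] /set0Pn[m mA] hA].
have [w tw mw] := lvertsP nv (subsetP sA m mA).
have [w' tw' mw'] := lvertsP nv m'v.
(* The leaves behind the markers of [A]. Connectedness yields a graph edge leaving [X], which
   becomes a label edge leaving [A]. *)
pose X := [set x | [exists w, [&& t v w, x \in sd v w & rho v w \in A]]].
have XP u x : t v u -> x \in sd v u -> (x \in X) = (rho v u \in A).
  move=> tu xu; rewrite inE; apply/existsP/idP => [[u' /and3P[tu' xu' uA]]|uA].
    by rewrite (side_eq T_glt tu tu' xu xu').
  by exists u; rewrite tu xu.
have [x xw] := side_neq0 T_glt tw; have [x' xw'] := side_neq0 T_glt tw'.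
have [||y [y' [yX y'X eyy']]] := connected_cut e_conn (X := X) (x := x) (y := x').
- by rewrite (XP w) // -mw.
- by rewrite (XP w') // -mw'.
have [u tu yu] := side_cover T_glt y nv; have [u' tu' yu'] := side_cover T_glt y' nv.
move: yX y'X; rewrite (XP u) // (XP u') // => uA u'A.
suff: ledge v (rho v u) (rho v u') by rewrite hA // inE u'A rho_lverts.
rewrite lq //; apply/sadjP; split; last by exists y, y'.
by apply: contraNneq u'A => <-.
Qed.

Definition clique_node v : bool :=
  locked (is_node v && [forall w in nbh v, forall w' in nbh v, sa v w w' == (w != w')]).

Definition star_node v c : Prop :=
  [/\ is_node v, t v c
    & forall w w', t v w -> t v w' -> sa v w w' = (w != w') && ((w == c) || (w' == c))].

Lemma clique_nodeP v : reflect
  (is_node v /\ forall w w', t v w -> t v w' -> sa v w w' = (w != w')) (clique_node v).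
Proof.
rewrite /clique_node -lock; apply: (iffP andP) => -[nv qv]; split=> //.
  by move=> w w' tw tw'; apply/eqP; move/forall_inP: qv => /(_ w _)/forall_inP->; rewrite ?inE.
by apply/forall_inP=> w; rewrite inE => tw; apply/forall_inP=> w'; rewrite inE => tw'; rewrite qv.
Qed.

Lemma clique_or_star_node v : is_node v -> clique_node v \/ exists c, star_node v c.
Proof.
move=> nv; have lq := ledge_sadj e_conn T_glt T_acc nv.
have [cl|[m [mv _ st]]] := cograph_label nv.
  left; apply/clique_nodeP; split=> // w w' tw tw'.
  by rewrite -lq // cl ?rho_eq // rho_lverts.
right; have [c tc mc] := lvertsP nv mv.
exists c; split=> // w w' tw tw'.
by rewrite -lq // st ?mc ?rho_eq // rho_lverts.
Qed.

Lemma clique_node_label v : clique_node v -> clique_on (lverts v) (ledge v).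
Proof.
case/clique_nodeP=> nv qv m m' /(lvertsP nv)[w tw ->] /(lvertsP nv)[w' tw' ->].
by rewrite (ledge_sadj e_conn T_glt T_acc) // qv // rho_eq.
Qed.

Lemma star_node_label v c : star_node v c -> star_on (lverts v) (ledge v) (rho v c).
Proof.
case=> nv tc qv; split; first exact: rho_lverts.
  by rewrite card_lverts // ltnW // split_tree_degree.
move=> m m' /(lvertsP nv)[w tw ->] /(lvertsP nv)[w' tw' ->].
by rewrite (ledge_sadj e_conn T_glt T_acc) // qv // !rho_eq.
Qed.

Lemma adjacent_cliques u v : t u v -> clique_node u -> ~~ clique_node v.
Proof.
move=> tuv cu; apply/negP=> cv.
have [_ [_ red _] _ _] := T_split.
case: (red u v); [by case/clique_nodeP: cu|by case/clique_nodeP: cv|by []|].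
by split; exact: clique_node_label.
Qed.

Lemma adjacent_stars u v c : t u v -> star_node u v -> star_node v c -> c = u.
Proof.
move=> tuv su sv; have [_ [_ _ red] _ _] := T_split.
have [[nu _ _] [nv tvc _]] := (su, sv).
have tvu : t v u by rewrite t_sym.
apply/eqP; rewrite -(@rho_eq v) //; apply/eqP.
have := red u v _ _ nu nv tuv (star_node_label su) (star_node_label sv).
case: (eqVneq (rho v c) (rho v u)) => // ne []; split=> //.
by apply/eqP; rewrite eq_sym.
Qed.

(** Degree at least 3 is essential: a single edge is both a star and a clique. *)
Lemma star_not_clique v c : star_node v c -> ~~ clique_node v.
Proof.
case=> nv tc qv; apply/negP=> /clique_nodeP[_ cv].
have [a ta ac] := node_nbr c nv.
have := split_tree_degree nv; rewrite /degree (cardsD1 c) (cardsD1 a) !inE tc ta ac.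
rewrite !add1n !ltnS => /card_gt0P[b]; rewrite !inE => /and3P[ba bc tb].
by have := qv a b ta tb; rewrite cv // [a == b]eq_sym ba (negPf ac) (negPf bc).
Qed.

(** * Full sides and the orientation of tree-edges *)

Definition full v w : bool := locked [forall x in sd v w, exists y in sd w v, e x y].

Lemma fullP v w : reflect
  (forall x, x \in sd v w -> exists2 y, y \in sd w v & e x y) (full v w).
Proof.
rewrite /full -lock; apply: (iffP forall_inP) => h x xw; first by have /exists_inP[y] := h x xw; exists y.
by apply/exists_inP; have [y] := h x xw; exists y.
Qed.

Lemma full_module v w x x' y : t v w -> full v w ->
  x \in sd v w -> x' \in sd v w -> y \notin sd v w -> e x y = e x' y.
Proof.
move=> tw /fullP fw xw x'w yw; have yv : y \in sd w v by rewrite -side_compl // inE.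
have [x0 x0v ex0] := fw x xw; have [x0' x0'v ex0'] := fw x' x'w.
apply/idP/idP => exy.
  exact: (crossing_split T_glt T_acc tw x'w xw x0'v yv ex0' exy).
exact: (crossing_split T_glt T_acc tw xw x'w x0v yv ex0 exy).
Qed.

(* Otherwise some [x] on the [w] side has no neighbour across the edge, and a
   path leaving the set of such vertices gives x1 - x2 - y2 - y1 induced. *)
Lemma full_or v w : t v w -> full v w || full w v.
Proof.
move=> tw; have tv : t w v by rewrite t_sym.
have half a b : t a b -> ~~ full a b -> exists x1 x2 y,
    [/\ x1 \in sd a b, x2 \in sd a b, e x1 x2 & y \in sd b a /\ e x2 y] /\
    forall z, z \in sd b a -> ~~ e x1 z.
  move=> tab; rewrite /full -lock negb_forall_in => /exists_inP[x xb xn].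
  pose X := [set x in sd a b | [forall y in sd b a, ~~ e x y]].
  have [y yb] := side_neq0 T_glt (etrans (t_sym b a) tab).
  have [||x1 [x2 [x1X x2X e12]]] := connected_cut e_conn (X := X) (x := x) (y := y).
  - by rewrite inE xb -negb_exists_in.
  - by move: yb; rewrite -side_compl // !inE => /negPf->.
  have [x1b n1] : x1 \in sd a b /\ forall z, z \in sd b a -> ~~ e x1 z.
    by move: x1X; rewrite inE => /andP[? /forall_inP].
  have x2b : x2 \in sd a b.
    by apply: contraLR e12 => x2b; apply: n1; rewrite -side_compl // inE.
  move: x2X; rewrite inE x2b -negb_exists_in negbK => /exists_inP[y' y'a ex2y'].
  by exists x1, x2, y'.
apply/norP=> -[/(half _ _ tw)[x1 [x2 [y0 [[x1w x2w e12 [y0v e20]] nx1]]]]].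
move=> /(half _ _ tv)[y1 [y2 [x0 [[y1v y2v f12 [x0w f20]] ny1]]]].
case: e_cog; exists x1, x2, y2, y1.
have neq x y : x \in sd v w -> y \in sd w v -> x != y.
  by move=> xw; rewrite -side_compl // inE; apply: contraNneq => <-.
have nself a b : e a b -> a != b by apply: contraTneq => ->; rewrite e_irr.
split.
- by rewrite /= !inE !negb_or [y2 == y1]eq_sym (nself _ _ e12) (nself _ _ f12) !neq.
- rewrite e12 (e_sym y2) f12 andbT /=.
  by apply: (crossing_split T_glt T_acc tw x2w x0w y0v y2v e20); rewrite e_sym.
- by rewrite !nx1 // e_sym ny1.
Qed.

Lemma full_down v w z : is_node w -> t v w -> full v w -> t w z -> z != v ->
  sa w v z /\ full w z.
Proof.
move=> nw tw /fullP fw tz zv; have tv : t w v by rewrite t_sym.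
have vz : v != z by rewrite eq_sym.
have sub : {subset sd w z <= sd v w} by exact/subsetP/(side_inner T_glt).
split.
  have [x xz] := side_neq0 T_glt tz; have [y yv exy] := fw x (sub x xz).
  by apply/sadjP; split=> //; exists y, x; split=> //; rewrite e_sym.
apply/fullP=> x xz; have [y yv exy] := fw x (sub x xz).
by exists y => //; exact: (side_opp T_glt tv tz vz).
Qed.

(** Converse of [full_down]. Fullness is thus decided locally: the marker towards [v] is universal
    at [w] and all edges leading further away are full. *)
Lemma full_up v w : is_node w -> t v w ->
  (forall z, t w z -> z != v -> sa w v z /\ full w z) -> full v w.
Proof.
move=> nw tw hw; have tv : t w v by rewrite t_sym.
apply/fullP=> x xw; have [z /andP[tz zv] xz] := side_next T_glt tw nw xw.
have [swvz /fullP/(_ x xz)[y yz exy]] := hw z tz zv.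
have [y' [x' [y'v x'w ey'x']]] := crossing_exists e_conn T_glt tv.
exists y' => //; apply: (sadj_rep tz tv _ xz _ exy y'v _ ey'x').
- by rewrite sadj_sym.
- by move: yz; rewrite -side_compl // inE.
- by move: x'w; rewrite -side_compl // inE.
Qed.

Lemma leaf_full v x : t v (leaf x) -> full v (leaf x).
Proof.
move=> tv; apply/fullP=> x'; rewrite (side_leaf T_glt) // => /set1P->.
have [x0 [y [+ yv exy]]] := crossing_exists e_conn T_glt tv.
by rewrite (side_leaf T_glt) // => /set1P x0x; rewrite x0x in exy; exists y.
Qed.

(* A clique node [w] with both sides of [vw] full is the root of MD(G), and then
   the leaves behind [w] do not form a strong module. *)
Definition down v w : bool := [&& t v w, full v w & ~~ (clique_node w && full w v)].

Lemma down_edge v w : down v w -> t v w. Proof. by case/and3P. Qed.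
Lemma down_full v w : down v w -> full v w. Proof. by case/and3P. Qed.

Lemma leaf_down v x : t v (leaf x) -> down v (leaf x).
Proof.
move=> tv; rewrite /down tv leaf_full //; apply/negP=> /andP[/clique_nodeP[]].
by rewrite leaf_not_node.
Qed.

(** A full direction is discarded only if its head is a clique node and the opposite direction is
    full too. The opposite head is then not a clique node, so that direction survives. *)
Lemma down_or v w : t v w -> down v w || down w v.
Proof.
move=> tw; have tv : t w v by rewrite t_sym.
have [cw|cw] := boolP (clique_node w).
  have cv := adjacent_cliques tv cw.
  have [fwv|fwv] := boolP (full w v); first by apply/orP; right; apply/and3P; rewrite (negPf cv).
  have := full_or tw; rewrite (negPf fwv) orbF => fvw.
  by apply/orP; left; apply/and3P; rewrite (negPf fwv) andbF.
have [fvw|fvw] := boolP (full v w); first by apply/orP; left; apply/and3P; rewrite (negPf cw).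
have := full_or tw; rewrite (negPf fvw) orFb => fwv.
by apply/orP; right; apply/and3P; rewrite (negPf fvw) andbF.
Qed.

(** The marker towards [v] is universal, and with at least three markers only the centre of a star
    is. *)
Lemma full_star v w c : t v w -> full v w -> star_node w c -> c = v.
Proof.
move=> tw fw [nw tc sw]; have tv : t w v by rewrite t_sym.
have [a ta av] := node_nbr v nw.
have := split_tree_degree nw; rewrite /degree (cardsD1 v) (cardsD1 a) !inE tv ta av.
rewrite !add1n !ltnS => /card_gt0P[b]; rewrite !inE => /and3P[ba bv tb].
have [+ _] := full_down nw tw fw ta av; have [+ _] := full_down nw tw fw tb bv.
rewrite !sw // => /andP[_ /orP[/eqP->//|/eqP<-]] /andP[_ /orP[/eqP->//|/eqP ab]].
by rewrite ab eqxx in ba.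
Qed.

Lemma full2_clique v v' w : is_node w -> t v w -> t v' w -> v != v' ->
  full v w -> full v' w -> clique_node w.
Proof.
move=> nw tv tv' vv' fv fv'; have [//|[c st]] := clique_or_star_node nw.
by rewrite -(full_star tv fv st) -(full_star tv' fv' st) eqxx in vv'.
Qed.

(** Only the tie-breaking clause needs an argument. If [z] were a clique node with [full z w], the
    label of [w] would have two universal markers, so [w] would be a clique node adjacent to [z]. *)
Lemma down_next v w z : down v w -> is_node w -> t w z -> z != v -> down w z.
Proof.
move=> dw nw tz zv; have [tw fw _] := and3P dw.
have [svz fz] := full_down nw tw fw tz zv.
rewrite /down tz fz /=; apply/negP=> /andP[cz fzw].
have tzw : t z w by rewrite t_sym.
have := adjacent_cliques tzw cz.
by rewrite (@full2_clique z v w).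
Qed.

(** Two parents would make [w] a clique node that is also full back towards [v'], exactly the case
    excluded by [down]. *)
Lemma down_unique v v' w : down v w -> down v' w -> v = v'.
Proof.
move=> dv dv'; have [tv fv _] := and3P dv; have [tv' fv' /negP nc] := and3P dv'.
have [nw|[x wx]] := node_or_leaf T_glt w; last first.
  by apply: (leaf_nbr T_glt (x := x)); rewrite -wx t_sym.
apply/eqP; apply/contraT => vv'; case: nc.
have twv' : t w v' by rewrite t_sym.
rewrite (full2_clique nw tv tv' vv') //.
by have [|_ ->] := full_down nw tv fv twv'; rewrite // eq_sym.
Qed.

Definition parentless w : bool := [forall v, ~~ down v w].

Lemma parentless_down w z : parentless w -> t w z -> down w z && ~~ down z w.
Proof.
by move=> /forallP/(_ z) nz tz; have := down_or tz; rewrite (negPf nz) orbF => ->.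
Qed.

(** At a parentless star node all edges to extremities are full, so the edge from the centre's
    direction is full by [full_up] and would provide a parent. *)
Lemma parentless_clique w : parentless w -> is_node w -> clique_node w.
Proof.
move=> pw nw; have [//|[c st]] := clique_or_star_node nw.
have [_ tc sw] := st; have tcw : t c w by rewrite t_sym.
have /forallP/(_ c)/negP[] := pw; rewrite /down tcw (negPf (star_not_clique st)) andbT /=.
apply: full_up => // z tz zc; rewrite sw // eqxx [c == z]eq_sym zc /=; split=> //.
by have /andP[/down_full] := parentless_down pw tz.
Qed.

Lemma down_branch w z u : down w z -> u \in branch t w z ->
  exists2 p, down p u & branch t p u \subset branch t w z.
Proof.
move: {2}(#|branch t w z|) (leqnn #|branch t w z|) => n.
elim: n w z => [|n IH] w z.
  by rewrite leqn0 cards_eq0 => /eqP b0; have := branch_root t w z; rewrite b0 inE.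
move=> bn dz uz; have tz := down_edge dz.
have [->|uz'] := eqVneq u z; first by exists w.
have [z2 /andP[tz2 z2w] uz2] := branch_next t_tree tz uz uz'.
have nz : is_node z.
  have [//|[x zx]] := node_or_leaf T_glt z; case/eqP: z2w.
  by apply: (leaf_nbr T_glt (x := x)); rewrite -zx // t_sym.
have [|p dp sp] := IH z z2 _ (down_next dz nz tz2 z2w) uz2.
  by rewrite -ltnS; apply: leq_trans bn; apply: proper_card; exact: branch_decr.
by exists p => //; apply: subset_trans sp _; exact: branch_inner.
Qed.

(** * Clusters, their children and strong modules *)

Lemma node_nbr3 w a b : is_node w -> exists z, [/\ t w z, z != a & z != b].
Proof.
move=> nw; have : 0 < #|nbh w :\ a :\ b|; last first.
  by case/card_gt0P=> z; rewrite !inE => /and3P[zb za tz]; exists z.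
have := split_tree_degree nw; rewrite /degree (cardsD1 a) (cardsD1 b).
by case: (a \in _); case: (b \in _); rewrite ?add1n ?add0n // => /ltnW // /ltnW.
Qed.

(* The vertex of MD(G) corresponding to [w], as a strong module. *)
Definition cluster w : {set V} := if [pick v | down v w] is Some v then sd v w else setT.

Lemma cluster_down v w : down v w -> cluster w = sd v w.
Proof.
move=> dv; rewrite /cluster; case: pickP => [v' dv'|/(_ v)]; last by rewrite dv.
by rewrite (down_unique dv dv').
Qed.

Lemma cluster_parentless w : parentless w -> cluster w = setT.
Proof.
by move=> /forallP pw; rewrite /cluster; case: pickP => // v dv; case/negP: (pw v).
Qed.

Lemma parentP w : (exists v, down v w) \/ parentless w.
Proof.
have [p|] := boolP (parentless w); first by right.
by rewrite negb_forall => /existsP[v]; rewrite negbK; left; exists v.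
Qed.

(** An edge that is [down] in both directions makes neither end a child of the other: both ends are
    children of the contracted root. *)
Definition child w z : bool := down w z && ~~ down z w.

Lemma child_edge w z : child w z -> t w z. Proof. by case/andP=> /down_edge. Qed.
Lemma child_full w z : child w z -> full w z. Proof. by case/andP=> /down_full. Qed.
Lemma child_cluster w z : child w z -> cluster z = sd w z.
Proof. by case/andP=> /cluster_down. Qed.

Lemma not_down_child w z : t w z -> ~~ down z w -> child w z.
Proof. by move=> tz nz; rewrite /child nz andbT; have := down_or tz; rewrite (negPf nz) orbF. Qed.

Lemma child_node w z : child w z -> is_node w.
Proof.
case/andP=> /down_edge tz nz; have [//|[x wx]] := node_or_leaf T_glt w.
by rewrite wx leaf_down // -wx t_sym in nz.
Qed.

Lemma cluster_leaf x : cluster (leaf x) = [set x].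
Proof.
have [[v dv]|p] := parentP (leaf x).
  by rewrite (cluster_down dv) (side_leaf T_glt) // down_edge.
(* A leaf without parent has no tree-neighbour, so the tree is a single vertex. *)
rewrite cluster_parentless //; apply/setP=> y; rewrite !inE; apply/esym/eqP.
case: (eqVneq (leaf y) (leaf x)) => [|ne]; first by case: T_glt => _ + _ _; apply.
have [v tv _] := branch_cover t_tree ne.
by have /forallP/(_ v)/negP[] := p; rewrite leaf_down // t_sym.
Qed.

Lemma cluster_cover w x : is_node w -> x \in cluster w -> exists2 z, child w z & x \in sd w z.
Proof.
move=> nw; have [[v dv]|p] := parentP w.
  rewrite (cluster_down dv) => xw.
  have [z /andP[tz zv] xz] := side_next T_glt (down_edge dv) nw xw.
  exists z => //; apply: not_down_child => //.
  by apply: contra zv => /(down_unique dv)->.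
move=> _; have [z tz xz] := side_cover T_glt x nw; exists z => //.
by apply: parentless_down.
Qed.

Lemma child_proper w z : child w z -> sd w z \proper cluster w.
Proof.
move=> cz; have tz := child_edge cz; have nw := child_node cz.
have [[v dv]|p] := parentP w.
  have tv := down_edge dv; rewrite (cluster_down dv).
  have zv : z != v by apply: contraTneq cz => ->; rewrite /child dv andbF.
  have [z' [tz' z'z z'v]] := node_nbr3 z v nw.
  have [x xz'] := side_neq0 T_glt tz'.
  apply/properP; split; first exact: side_inner.
  exists x; first exact: (subsetP (side_inner T_glt tv tz' z'v)).
  exact: (side_disjoint T_glt tz' tz z'z).
rewrite cluster_parentless // properT; apply/eqP=> zT.
have [x] := side_neq0 T_glt (etrans (t_sym z w) tz).
by rewrite -side_compl // zT !inE.
Qed.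

Lemma child_star w z c : child w z -> star_node w c -> z != c.
Proof.
move=> cz st; have nw := child_node cz; have [[v dv]|p] := parentP w.
  rewrite (full_star (down_edge dv) (down_full dv) st).
  by apply: contraTneq cz => ->; rewrite /child dv andbF.
by have := star_not_clique st; rewrite parentless_clique.
Qed.

(** The children of a node are twins in its label: the node is a clique, or a star whose centre
    points to the parent. *)
Lemma child_sadj w z1 z2 u : child w z1 -> child w z2 -> t w u -> u != z1 -> u != z2 ->
  sa w z1 u -> sa w z2 u.
Proof.
move=> c1 c2 tu u1 u2; have nw := child_node c1.
have [t1 t2] := (child_edge c1, child_edge c2).
have [/clique_nodeP[_ qw]|[c st]] := clique_or_star_node nw.
  by rewrite !qw // [z2 == u]eq_sym u2.
have [_ _ qw] := st; rewrite !qw // (negPf (child_star c1 st)) => /andP[_ /= ->].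
by rewrite orbT andbT eq_sym.
Qed.

Lemma full_sadj w z x : t w z -> full w z -> x \in sd w z ->
  exists2 y, y \notin sd w z & e x y.
Proof.
move=> tz /fullP fz xz; have [y yw exy] := fz x xz; exists y => //.
by move: yw; rewrite -side_compl // inE.
Qed.

Lemma sadj_edge w z z' x y : t w z -> t w z' -> z != z' ->
  x \in sd w z -> y \in sd w z' -> e x y -> sa w z z'.
Proof. by move=> tz tz' zz' xz yz' exy; apply/sadjP; split=> //; exists x, y. Qed.

Lemma child_pair_module w z1 z2 : child w z1 -> child w z2 ->
  is_module e (sd w z1 :|: sd w z2).
Proof.
have key a b x y r : child w a -> child w b -> x \in sd w a -> y \in sd w b ->
    r \notin sd w a -> r \notin sd w b -> e x r -> e y r.
  move=> ca cb xa yb ua ub exu; have nw := child_node ca.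
  have [ta tb] := (child_edge ca, child_edge cb).
  have [u' tu' uu'] := side_cover T_glt r nw.
  have u'a : u' != a by apply: contraNneq ua => <-.
  have u'b : u' != b by apply: contraNneq ub => <-.
  have au' : a != u' by rewrite eq_sym.
  have [y' y'b eyy'] := full_sadj tb (child_full cb) yb.
  apply: (sadj_rep tb tu' _ yb y'b eyy' uu' _ (etrans (e_sym r x) exu)).
    by apply: (child_sadj ca cb) => //; apply: (sadj_edge ta tu' au' xa uu').
  exact: (side_disjoint T_glt ta tu' au').
move=> c1 c2; apply/moduleP=> x y r; rewrite !in_setU negb_or => xK yK /andP[u1 u2].
have [a [ca ua xa]] : exists a, [/\ child w a, r \notin sd w a & x \in sd w a].
  by case/orP: xK; [exists z1|exists z2].
have [b [cb ub yb]] : exists b, [/\ child w b, r \notin sd w b & y \in sd w b].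
  by case/orP: yK; [exists z1|exists z2].
by apply/idP/idP; [exact: (key a b)|exact: (key b a)].
Qed.

(** Unions of two children are modules. If [M] fit into no child, the union of a child meeting [M]
    with a child not contained in [M] would overlap [M]. *)
Lemma strong_in_child w (M : {set V}) : strong_module e M -> M \proper cluster w ->
  exists2 z, child w z & M \subset sd w z.
Proof.
move=> /strong_moduleP[/set0Pn[x xM] mM sM] /properP[sMw [m mw mM']].
have nw : is_node w.
  have [//|[y wy]] := node_or_leaf T_glt w.
  move: mw mM' (subsetP sMw x xM); rewrite wy cluster_leaf => /set1P my nM /set1P xy.
  by rewrite my -xy xM in nM.
have [z1 c1 x1] := cluster_cover nw (subsetP sMw x xM).
have [z2 c2 m2] := cluster_cover nw mw.
have [t1 t2] := (child_edge c1, child_edge c2).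
have [M1|/subsetPn[x3 x3M x31]] := boolP (M \subset sd w z1); first by exists z1.
have [M2|/subsetPn[x4 x4M x42]] := boolP (M \subset sd w z2); first by exists z2.
have mod1 z : child w z -> is_module e (sd w z).
  by move=> cz; have := child_pair_module cz cz; rewrite setUid.
have M2 : [disjoint M & sd w z2].
  case/or3P: (sM _ (mod1 _ c2)) => //; first by move=> /subsetP/(_ _ x4M); rewrite (negPf x42).
  by move=> /subsetP/(_ _ m2); rewrite (negPf mM').
case/or3P: (sM _ (child_pair_module c1 c2)).
- by move=> /disjointFr/(_ xM); rewrite inE x1.
- move=> /subsetP/(_ _ x3M); rewrite inE (negPf x31) /= => x32.
  by rewrite (disjointFr M2 x3M) in x32.
- by move=> /subsetP/(_ m); rewrite inE m2 orbT (negPf mM') => /(_ isT).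
Qed.

(** Leaves of distinct children are adjacent exactly when [w] is a clique node. If [p] and [q] share
    a child, a leaf of another child lies in [P] or [Q] and replaces one of them. *)
Lemma child_cut w b (P Q : {set V}) : is_node w -> P :|: Q = cluster w ->
  P != set0 -> Q != set0 -> (forall p q, p \in P -> q \in Q -> e p q = b) ->
  b = clique_node w.
Proof.
move=> nw PQ /set0Pn[p pP] /set0Pn[q qQ] hb.
have kb z z' x y : child w z -> child w z' -> z != z' -> x \in sd w z -> y \in sd w z' ->
    e x y = clique_node w.
  move=> cz cz' zz' xz yz'; have [tz tz'] := (child_edge cz, child_edge cz').
  have [cl|[c st]] := clique_or_star_node nw.
    rewrite cl; case/clique_nodeP: (cl) => _ qw.
    have [x' x'z exx'] := full_sadj tz (child_full cz) xz.
    have [y' y'z' eyy'] := full_sadj tz' (child_full cz') yz'.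
    by apply: (sadj_rep tz tz' _ xz x'z exx' yz' y'z' eyy'); rewrite qw.
  rewrite (negPf (star_not_clique st)); apply/negP=> exy; have [_ _ qw] := st.
  have := sadj_edge tz tz' zz' xz yz' exy.
  by rewrite qw // (negPf (child_star cz st)) (negPf (child_star cz' st)) andbF.
have pw : p \in cluster w by rewrite -PQ inE pP.
have qw : q \in cluster w by rewrite -PQ inE qQ orbT.
have [z cz pz] := cluster_cover nw pw; have [z' cz' qz'] := cluster_cover nw qw.
have [zz'|zz'] := eqVneq z z'; last by rewrite -(hb p q pP qQ) (kb z z').
have /properP[_ [m mw mz]] := child_proper cz.
have [z2 cz2 mz2] := cluster_cover nw mw.
have z2z : z2 != z by apply: contraNneq mz => <-.
have [zz2 qz] : z != z2 /\ q \in sd w z by rewrite eq_sym z2z zz'.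
move: mw; rewrite -PQ inE => /orP[mP|mQ].
  by rewrite -(hb m q mP qQ) (kb z2 z).
by rewrite -(hb p m pP mQ) (kb z z2).
Qed.

Lemma full_or_star v z c : t v z -> star_node v c -> z != c -> full v z.
Proof.
move=> tz st zc; have tv : t z v by rewrite t_sym.
have /orP[//|fz] := full_or tz.
by rewrite (full_star tv fz st) eqxx in zc.
Qed.

(** A module [K] overlapping the cluster cuts it uniformly, in the colour dictated by the label of
    [w]. Reducedness then restricts the label of the parent [v], and a leaf [y] beyond a third
    neighbour of [v] contradicts the choice of [K]. *)
Lemma strong_cluster w : strong_module e (cluster w).
Proof.
have [nw|[x0 ->]] := node_or_leaf T_glt w; last first.
  by rewrite cluster_leaf; case/andP: (modular_leaf_subproof e x0).
have [[v dv]|p] := parentP w; last first.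
  rewrite cluster_parentless //; apply/strong_moduleP; split.
  - by apply/set0Pn; case: e_conn => /card_gt0P[x _] _; exists x.
  - by apply/moduleP=> x y u _ _; rewrite inE.
  - by move=> K _; rewrite subsetT !orbT.
have [tw fw nc] := and3P dv; have tv : t w v by rewrite t_sym.
have Mw := cluster_down dv.
apply/strong_moduleP; split.
- by rewrite Mw; apply/set0Pn; apply: side_neq0.
- by rewrite Mw; apply/moduleP=> x y u; exact: full_module.
move=> K mK; apply/contraT=> ov.
have mM : is_module e (cluster w) by rewrite Mw; apply/moduleP=> x y u; exact: full_module.
have [b [k [c0 [kKM cMK hMK hKM]]]] := overlapping_modules e_sym mM mK ov.
have bE : b = clique_node w.
  apply: (child_cut nw (setID (cluster w) K) _ _ hMK); first by apply/set0Pn; exists c0.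
  by move: ov; rewrite !negb_or => /and3P[_ + _]; rewrite -setD_eq0.
have /setIP[cM cK] := cMK; have /setDP[kK kM] := kKM.
rewrite Mw in cM kM hKM kKM.
have kv : k \in sd w v by rewrite -side_compl // inE.
have ekc : e k c0 = b by exact: hKM.
have [c0' c0'w ec0'] := full_sadj tw fw cM.
have KmodP y : y \notin K -> e k y = e c0 y by move=> yK; apply: (moduleP _ _ mK).
case: b bE hKM ekc {hMK} => bE hKM ekc.
(* Here [v] is a star whose centre [d] is not [w]: a clique is excluded next to [w], and centre [w]
   would give [full w v]. Being adjacent to [c0], [k] lies beyond [d]. The leaf [y] is adjacent to
   [k] but to nothing in the cluster, so it fits neither inside nor outside [K]. *)
- have cw : clique_node w by [].
  have fv : ~~ full w v by move: nc; rewrite cw.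
  have [nv|[x0 vx]] := node_or_leaf T_glt v; last by rewrite vx leaf_full // -vx in fv.
  have [cv|[d st]] := clique_or_star_node nv.
    by have := adjacent_cliques tw cv; rewrite cw.
  have [_ td sv] := st.
  have dw : d != w.
    apply: contra fv => /eqP dw; apply: full_up => // z tz zw.
    by rewrite sv // dw eqxx [w == z]eq_sym zw; split=> //; apply: (full_or_star tz st); rewrite dw.
  have [z tz kz] := side_cover T_glt k nv.
  have zw : z != w by apply: contraNneq kM => <-.
  have zd : z = d.
    apply/eqP; have := sadj_edge tz tw zw kz cM ekc.
    by rewrite sv // [w == d]eq_sym (negPf dw) orbF => /andP[].
  have [z' [tz' z'w z'd]] := node_nbr3 w d nv.
  have fz' := full_or_star tz' st z'd.
  have [y yz'] := side_neq0 T_glt tz'.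
  have [y' y'z' eyy'] := full_sadj tz' fz' yz'.
  have z'z : z' != z by rewrite zd.
  have cz : c0 \notin sd v z by apply: (side_disjoint T_glt tw tz _ cM); rewrite eq_sym.
  have eyk : e y k.
    apply: (sadj_rep tz' tz _ yz' y'z' eyy' kz cz ekc).
    by rewrite sv // z'z zd eqxx orbT.
  have nyc m : m \in sd v w -> ~~ e y m.
    move=> mw; apply/negP=> eym; have := sadj_edge tz' tw z'w yz' mw eym.
    by rewrite sv // (negPf z'd) [w == d]eq_sym (negPf dw) andbF.
  have yw : y \notin sd v w by exact: (side_disjoint T_glt tz' tw z'w).
  have yK : y \notin K.
    by apply/negP=> yK; have := nyc c0 cM; rewrite hKM // inE yw.
  by have := nyc c0 cM; rewrite e_sym -KmodP // e_sym eyk.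
(* Now [w] is a star centred towards [v], so reducedness makes [w] universal at [v]. Not being
   adjacent to [c0], [k] has no neighbour outside its own side [z], which forces [full z v]. The
   leaf [y] is adjacent to [c0] but not to [k], again impossible inside or outside [K]. *)
- have ncw : ~~ clique_node w by rewrite -bE.
  have [|[c st]] := clique_or_star_node nw; first by rewrite (negPf ncw).
  have cv := full_star tw fw st; rewrite {}cv in st.
  have [nv|[x0 vx]] := node_or_leaf T_glt v; last first.
    have /fullP/(_ c0 cM)[y + ec0y] := fw.
    rewrite vx (side_leaf T_glt) -?vx // => /set1P yx0.
    move: kv; rewrite vx (side_leaf T_glt) -?vx // => /set1P kx0.
    by rewrite e_sym yx0 -kx0 ekc in ec0y.
  have svw z : t v z -> z != w -> sa v z w.
    move=> tz zw; have [/clique_nodeP[_ ->]//|[d sd']] := clique_or_star_node nv.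
    have [_ _ ->//] := sd'; rewrite (adjacent_stars tv st sd') eqxx zw orbT.
    by [].
  have [z tz kz] := side_cover T_glt k nv.
  have zw : z != w by apply: contraNneq kM => <-.
  have kiso y : y \notin sd v z -> ~~ e k y.
    move=> yz; apply/negP=> eky; move: (sadj_rep tz tw (svw z tz zw) kz yz eky cM c0'w ec0').
    by rewrite ekc.
  have fzv : full z v.
    have /orP[/(full_sadj tz)/(_ kz)[y yz eky]|//] := full_or tz.
    by have := kiso y yz; rewrite eky.
  have tzv : t z v by rewrite t_sym.
  have [z' [tz' z'w z'z]] := node_nbr3 w z nv.
  have [_ fz'] := full_down nv tzv fzv tz' z'z.
  have [y yz'] := side_neq0 T_glt tz'.
  have [y' y'z' eyy'] := full_sadj tz' fz' yz'.
  have eyc : e y c0 by exact: (sadj_rep tz' tw (svw z' tz' z'w) yz' y'z' eyy' cM c0'w ec0').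
  have yw : y \notin sd v w by exact: (side_disjoint T_glt tz' tw z'w).
  have yK : y \notin K.
    by apply/negP=> yK; move: eyc; rewrite hKM // inE yw.
  have := kiso y (side_disjoint T_glt tz' tz z'z yz').
  by rewrite KmodP // e_sym eyc.
Qed.

Lemma children_cluster w : children e (cluster w) = [set cluster z | z in child w].
Proof.
apply/setP=> N; rewrite inE; apply/and3P/imsetP => [[sN pN /forall_inP maxN]|[z cz ->]].
  have [z cz Nz] := strong_in_child sN pN; exists z => //.
  apply/eqP; rewrite (child_cluster cz); apply/contraT=> ne.
  have := maxN (cluster z) (strong_cluster z).
  by rewrite (child_cluster cz) (child_proper cz) properEneq ne Nz.
split; first exact: strong_cluster.
  by rewrite (child_cluster cz) child_proper.
apply/forall_inP=> K sK; apply/negP=> /andP[zK Kw].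
have [z' cz' Kz'] := strong_in_child sK Kw.
rewrite (child_cluster cz) in zK; have [tz tz'] := (child_edge cz, child_edge cz').
have pzz' : sd w z \proper sd w z' := proper_sub_trans zK Kz'.
have [x xz] := side_neq0 T_glt tz.
have zz' : z = z' by apply: (side_eq T_glt tz tz' xz); apply: (subsetP (proper_sub pzz')).
by rewrite zz' properxx in pzz'.
Qed.

(** If the step from [w] towards [w'] went to a child, the cluster of [w'] would be strictly
    smaller. So the parents of [w] and [w'] lie towards each other, and their clusters are disjoint
    and nonempty. *)
Lemma cluster_inj : injective cluster.
Proof.
have aux w w' z : w != w' -> cluster w = cluster w' -> t w z -> w' \in branch t w z -> down z w.
  move=> ww' eqc tz w'z; apply/contraT=> nd; have cz := not_down_child tz nd.
  have [p dp sp] := down_branch (proj1 (andP cz)) w'z.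
  have : cluster w' \subset sd w z.
    rewrite (cluster_down dp); apply/subsetP=> x; rewrite !in_side.
    exact: (subsetP sp).
  by rewrite -eqc; have := child_proper cz; rewrite properE => /andP[_ /negPf->].
move=> w w' eqc; apply/eqP/contraT=> ww'; have w'w : w' != w by rewrite eq_sym.
have [z tz w'z] := branch_cover t_tree w'w; have [z' tz' wz'] := branch_cover t_tree ww'.
have dz := aux w w' z ww' eqc tz w'z.
have dz' := aux w' w z' w'w (esym eqc) tz' wz'.
have := eqc; rewrite (cluster_down dz) (cluster_down dz') => eqs.
have tz'w' : t z' w' by rewrite t_sym.
have [x xw'] := side_neq0 T_glt tz'w'.
have : x \in sd w z.
  by move: xw'; rewrite !in_side; apply: (subsetP (branch_facing t_tree tz tz' w'z wz')).
have tzw : t z w by rewrite t_sym.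
by rewrite -(side_compl T_glt tzw) in_setC eqs xw'.
Qed.

(** * The root and its contraction *)

Lemma cluster_setT_parentless w : cluster w = setT -> parentless w.
Proof.
move=> wT; have [[v dv]|//] := parentP w; have tw := down_edge dv.
have [x] := side_neq0 T_glt (etrans (t_sym w v) tw).
by rewrite -side_compl // inE -(cluster_down dv) wT inE.
Qed.

Lemma mutual_cover v w (N : {set V}) : down v w -> down w v ->
  strong_module e N -> N \proper setT -> N \subset cluster w \/ N \subset cluster v.
Proof.
move=> dw dv /strong_moduleP[_ _ sN] NT.
have cwC : cluster v = ~: cluster w.
  by rewrite (cluster_down dw) (cluster_down dv) side_compl // down_edge.
have mod1 u : is_module e (cluster u) by have /strong_moduleP[] := strong_cluster u.
case/or3P: (sN _ (mod1 w)); rewrite ?cwC -?disjoints_subset; [by right|by left|move=> wN].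
case/or3P: (sN _ (mod1 v)); rewrite ?cwC -?disjoints_subset ?setCK; [|by right|move=> vN].
  by rewrite disjoints_subset setCK; left.
move: NT; rewrite properT => /eqP[]; apply/eqP.
by rewrite -subTset -(setUCr (cluster w)) subUset wN.
Qed.

(* The edge [vw] then arises from contracting a root-incident edge of MD(G). *)
Lemma mutual_children v w : down v w -> down w v ->
  children e setT = [set cluster v; cluster w].
Proof.
move=> dw dv; have [tw tv] := (down_edge dw, down_edge dv).
have [cw cv] := (cluster_down dw, cluster_down dv).
have cwC : cluster v = ~: cluster w by rewrite cw cv side_compl.
have [x xv] := side_neq0 T_glt tv; have [y yw] := side_neq0 T_glt tw.
rewrite -cv in xv; rewrite -cw in yw.
have cover := fun N => @mutual_cover v w N dw dv.
have pr u : u = v \/ u = w -> cluster u \proper setT.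
  move=> uvw; rewrite properT; apply/eqP=> uT; case: uvw => uE; rewrite uE in uT.
    by move: yw; rewrite -[cluster w]setCK -cwC uT !inE.
  by move: xv; rewrite cwC uT !inE.
have xw : x \notin cluster w by rewrite -in_setC -cwC.
have yv : y \notin cluster v by rewrite cwC in_setC yw.
have maxi u (N : {set V}) : u = v \/ u = w -> N \subset cluster u ->
    [forall K, strong_module e K ==> ~~ ((N \proper K) && (K \proper setT))] -> N = cluster u.
  move=> uvw Nu /forall_inP/(_ _ (strong_cluster u)); rewrite (pr u uvw) andbT properEneq Nu andbT.
  by rewrite negbK => /eqP.
apply/setP=> N; rewrite inE in_set2; apply/and3P/orP=> [[sN NT mN]|].
  by have [Nw|Nv] := cover N sN NT; [right|left]; apply/eqP; apply: maxi => //; [right|left].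
have out u z : u = v \/ u = w -> z \notin cluster u ->
    (forall N : {set V}, N \subset cluster v \/ N \subset cluster w -> cluster u \proper N -> False) ->
    [/\ strong_module e (cluster u), cluster u \proper setT
      & [forall K, strong_module e K ==> ~~ ((cluster u \proper K) && (K \proper setT))]].
  move=> uvw zu h; split; [exact: strong_cluster|exact: pr|].
  apply/forall_inP=> K sK; apply/negP=> /andP[uK KT].
  by have [Kw|Kv] := cover K sK KT; apply: h uK; [right|left].
case=> /eqP-> {N}.
  apply: (out v y); [by left|by []|] => N [Nv|Nw] /properP[sN [z zN zv]].
    by rewrite (subsetP Nv z zN) in zv.
  by have := subsetP Nw x (subsetP sN x xv); rewrite (negPf xw).
apply: (out w x); [by right|by []|] => N [Nv|Nw] /properP[sN [z zN zv]].
  by have := subsetP Nv y (subsetP sN y yw); rewrite (negPf yv).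
by rewrite (subsetP Nw z zN) in zv.
Qed.

Lemma mutual_exists : (forall w, ~~ parentless w) -> exists v w, down v w && down w v.
Proof.
move=> np; have [x0 _] : exists x : V, x \in setT.
  by case: e_conn => /card_gt0P[x _] _; exists x.
(* The parent of a vertex with largest cluster must also be its child in the orientation, since
   otherwise the parent's cluster would be larger. *)
pose w := [arg max_(w > leaf x0) #|cluster w|].
have maxw u : #|cluster u| <= #|cluster w|.
  by rewrite /w; case: arg_maxnP => // w' _; apply.
have [[v dw]|p] := parentP w; last by rewrite (negPf (np w)) in p.
exists v, w; rewrite dw /=; apply/contraT=> ndv.
have cw : child v w by rewrite /child dw.
have := maxw v; rewrite leqNgt (child_cluster cw) proper_card //.
exact: child_proper.
Qed.

(** A parentless node has as many children as its degree, at least 3, and a parentless leaf has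
    none. Without a parentless vertex, a mutual edge yields exactly two children of [setT]. *)
Lemma contracted_parentless : contracted_root e = [forall w, ~~ parentless w].
Proof.
rewrite /contracted_root; have [/forallP np|] := boolP [forall w, ~~ parentless w].
  have [v [w /andP[dw dv]]] := mutual_exists np.
  rewrite (mutual_children dw dv) cards2 (inj_eq cluster_inj).
  by rewrite (tree_edge_neq t_tree (down_edge dv)).
rewrite negb_forall => /existsP[r]; rewrite negbK => pr.
rewrite -(cluster_parentless pr) children_cluster card_imset; last exact: cluster_inj.
have [nr|[x rx]] := node_or_leaf T_glt r; last first.
  rewrite eq_card0 // => z; apply/negP=> /child_node.
  by rewrite rx leaf_not_node.
have -> : #|child r| = degree r.
  apply: eq_card => z; rewrite inE; apply/idP/idP; first exact: child_edge.
  exact: parentless_down.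
by apply/negbTE; rewrite neq_ltn split_tree_degree ?orbT.
Qed.

Lemma cluster_vertex w : modular_vertex_pred e (cluster w).
Proof.
rewrite /modular_vertex_pred strong_cluster; apply/negP=> /andP[].
rewrite contracted_parentless => /forallP/(_ w) np /eqP/cluster_setT_parentless.
by rewrite (negPf np).
Qed.

Lemma cluster_below w (M : {set V}) : strong_module e M -> M \subset cluster w ->
  exists u, cluster u = M.
Proof.
move=> sM; move: {2}(#|cluster w|) (leqnn #|cluster w|) => n.
elim: n w => [|n IH] w.
  rewrite leqn0 cards_eq0 => /eqP->; rewrite subset0 => /eqP M0.
  by case/and3P: sM; rewrite M0 eqxx.
move=> wn; rewrite subEproper => /orP[/eqP->|pM]; first by exists w.
have [z cz Mz] := strong_in_child sM pM.
apply: (IH z); rewrite (child_cluster cz) // -ltnS; apply: leq_trans wn.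
by apply: proper_card; exact: child_proper.
Qed.

Lemma cluster_surj (M : {set V}) : modular_vertex_pred e M -> exists u, cluster u = M.
Proof.
case/andP=> sM; rewrite contracted_parentless.
have [/forallP np /= MT|] := boolP [forall w, ~~ parentless w]; last first.
  rewrite negb_forall => /existsP[r]; rewrite negbK => pr _.
  by apply: (@cluster_below r) => //; rewrite cluster_parentless.
have [v [w /andP[dw dv]]] := mutual_exists np.
have MT' : M \proper setT by rewrite properT.
have [] : M \subset cluster w \/ M \subset cluster v by exact: (mutual_cover dw dv).
  exact: cluster_below.
exact: cluster_below.
Qed.

(** * The isomorphism with the modular tree *)

Lemma mem_children_cluster v w : (cluster w \in children e (cluster v)) = child v w.
Proof.
rewrite children_cluster; apply/imsetP/idP => [[z cz /cluster_inj->//]|cw].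
by exists w.
Qed.

Definition cluster_vtx v : modular_vertex e := exist _ (cluster v) (cluster_vertex v).

Lemma modular_edge_cluster v w : modular_edge (cluster_vtx v) (cluster_vtx w) = t v w.
Proof.
rewrite /modular_edge /= !mem_children_cluster; apply/idP/idP.
  case/or3P=> [/child_edge//|/child_edge|]; first by rewrite t_sym.
  case/and4P; rewrite contracted_parentless => /forallP np ne.
  have [a [b /andP[da db]]] := mutual_exists np.
  rewrite (mutual_children da db) !in_set2 !(inj_eq cluster_inj).
  have [tab tba] := (down_edge da, down_edge db).
  by case/orP=> /eqP vE /orP[]/eqP wE; move: ne; rewrite vE wE ?eqxx.
move=> tvw; have tw : t w v by rewrite t_sym.
have [dwv|ndwv] := boolP (down w v); last by rewrite not_down_child.
have [dvw|ndvw] := boolP (down v w); last by rewrite [child w v]not_down_child ?orbT.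
have := mutual_children dvw dwv; rewrite /contracted_root => ->.
rewrite cards2 !in_set2 !eqxx !(inj_eq cluster_inj) [v == w]eq_sym.
by rewrite (negPf (tree_edge_neq t_tree tvw)) !orbT.
Qed.

(** [pick] inverts [rho v]. The default [None] is irrelevant, because at a node every marker of the
    label belongs to some tree-edge. *)
Definition marker_map v (m : marker T) : modular_marker V :=
  if [pick w | t v w && (rho v w == m)] is Some w
  then modular_rho (cluster_vtx v) (cluster_vtx w) else None.

Lemma marker_map_rho v w : is_node v -> t v w ->
  marker_map v (rho v w) = if child v w then Some (cluster w) else None.
Proof.
move=> nv tw; rewrite /marker_map; case: pickP => [w' /andP[tw']|/(_ w)].
  by rewrite rho_eq // => /eqP->; rewrite /modular_rho /= mem_children_cluster.
by rewrite tw eqxx.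
Qed.

Lemma not_child_full v w : t v w -> ~~ child v w -> down w v.
Proof. by move=> tw; apply: contraR => /(not_down_child tw). Qed.

Lemma split_tree_modular : glt_iso T (modular_glt e).
Proof.
have surj M : exists u, cluster_vtx u == M.
  by have [u uM] := cluster_surj (valP M); exists u; apply/eqP/val_inj.
exists cluster_vtx, marker_map; split.
- exists (fun M => xchoose (surj M)) => [v|M]; last exact/eqP/(xchooseP (surj M)).
  by have /eqP[/cluster_inj] := xchooseP (surj (cluster_vtx v)).
- exact: modular_edge_cluster.
- by move=> x; apply: val_inj; rewrite /= cluster_leaf.
move=> v nv; split.
- move=> m m' /(lvertsP nv)[w tw ->] /(lvertsP nv)[w' tw' ->].
  rewrite !marker_map_rho //; have [cw|cw] := boolP (child v w).
    by have [_ [/cluster_inj->]|//] := boolP (child v w').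
  have [//|cw' _] := boolP (child v w').
  by rewrite (down_unique (not_child_full tw cw) (not_child_full tw' cw')).
- apply/setP=> -[N|]; rewrite [RHS]in_set /=; apply/imsetP/idP.
  + case=> m /(lvertsP nv)[w tw ->]; rewrite marker_map_rho //.
    by case: ifP => // cw [->]; rewrite mem_children_cluster.
  + rewrite children_cluster => /imsetP[w cw ->]; have tw := child_edge cw.
    by exists (rho v w); rewrite ?rho_lverts // marker_map_rho // (cw : child v w).
  + case=> m /(lvertsP nv)[w tw ->]; rewrite marker_map_rho //.
    case: ifPn => // cw _; apply/eqP=> /cluster_setT_parentless/forallP/(_ w).
    by rewrite not_child_full.
  + move=> vT; have [[w dw]|p] := parentP v; last by rewrite cluster_parentless ?eqxx in vT.
    have tw : t v w by rewrite t_sym down_edge.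
    by exists (rho v w); rewrite ?rho_lverts // marker_map_rho // /child dw andbF.
- move=> m m' /(lvertsP nv)[w tw ->] /(lvertsP nv)[w' tw' ->].
  rewrite !marker_map_rho // (ledge_sadj e_conn T_glt T_acc) //=.
  (* A neighbour that is not a child is the parent, whose marker is universal by [full_down]. This
     is the extra marker [None] of the modular label. *)
  have up u u' : t v u -> t v u' -> ~~ child v u -> u != u' -> sa v u u'.
    move=> tu tu' cu uu'; have du := not_child_full tu cu.
    by case: (full_down nv (down_edge du) (down_full du) tu'); rewrite // eq_sym.
  have [cw|cw] := boolP (child v w); have [cw'|cw'] := boolP (child v w') => /=.
  + by rewrite /quotient_edge (inj_eq cluster_inj) (child_cluster cw) (child_cluster cw').
  + by rewrite sadj_sym ?up //; apply: contraNneq cw' => ->.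
  + by rewrite up //; apply: contraNneq cw => ->.
  + by rewrite (down_unique (not_child_full tw cw) (not_child_full tw' cw')) /sadj eqxx.
- by move=> w; rewrite inE => tw; rewrite marker_map_rho //= /modular_rho /= mem_children_cluster.
Qed.

End CographLabels.

(** * Labels of the modular tree *)

Lemma clique_or_star_p4_free (W : finType) (S : {set W}) (h : rel W) :
  clique_or_star_on S h -> p4_free h S.
Proof.
case=> [cl|[z [zS _ st]]] a b c d aS bS cS dS; apply/negP=> /and5P[].
  rewrite /= !inE !negb_or => /and4P[/and3P[_ ac _] _ _ _] _ _ _ /and3P[].
  by rewrite cl // ac.
rewrite /= !inE !negb_or => /and4P[/and3P[ab ac ad] /andP[bc bd] cd _].
rewrite !st // ab ac ad bc bd cd /= => /orP[]/eqP-> _ /orP[]/eqP-> /and3P[];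
  rewrite ?eqxx ?orbT //.
Qed.

Lemma modular_clique_star_cograph (V : finType) (e : rel V) (T : glt V) :
  symmetric e -> is_glt T -> glt_iso T (modular_glt e) -> clique_star_tree T ->
  cograph e.
Proof.
move=> e_sym T_glt [f [g [f_bij _ f_leaf f_lab]]] T_cs [a [b [c [d [uq]]]]].
case/and3P=> eab ebc ecd /and3P[eac ebd ead].
have P : p4 e a b c d by rewrite /p4 uq eab ebc ecd eac ebd.
pose Q N := strong_module e N && [&& a \in N, b \in N, c \in N & d \in N].
have QT : Q setT.
  rewrite /Q !inE !andbT; apply/strong_moduleP; split.
  - by apply/set0Pn; exists a.
  - by apply/moduleP=> x y u _ _; rewrite inE.
  - by move=> K _; rewrite subsetT !orbT.
case: (@arg_minnP _ setT Q (fun N => #|N|) QT) => M /andP[sM /and4P[aM bM cM dM]] minM.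
have M4 : 3 < #|M|.
  rewrite cardE; apply: (uniq_leq_size uq) => x.
  by rewrite mem_enum !inE => /or4P[]/eqP->.
have M1 : 1 < #|M| by apply: leq_trans M4.
have [A cA aA] := children_cover sM aM M1; have [B cB bB] := children_cover sM bM M1.
have [C cC cC'] := children_cover sM cM M1; have [D cD dD] := children_cover sM dM M1.
have few N : N \in children e M -> (a \in N) + (b \in N) + (c \in N) + (d \in N) <= 1.
  move=> cN; rewrite leqNgt; apply/negP=> N2; have [sN pN _] := childrenP cN.
  have /strong_moduleP[_ mN _] := sN; have := minM N.
  by rewrite /Q sN (p4_module e_sym mN P N2) /= leqNgt proper_card // => /(_ isT).
have uqN : uniq [:: A; B; C; D].
  have neq (X Y : {set V}) x y : x \in X -> y \in Y -> Y \in children e M ->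
      (x \in Y -> y \in Y -> 1 < (a \in Y) + (b \in Y) + (c \in Y) + (d \in Y)) -> X != Y.
    move=> xX yY cY h; apply: contraL (few Y cY) => /eqP XY.
    by rewrite -ltnNge h // -XY.
  rewrite /= !inE !negb_or !andbT; apply/and3P; split; [apply/and3P; split|apply/andP; split|].
  - by apply: (neq A B a b) => // -> ->; case: (c \in B); case: (d \in B).
  - by apply: (neq A C a c) => // -> ->; case: (b \in C); case: (d \in C).
  - by apply: (neq A D a d) => // -> ->; case: (b \in D); case: (c \in D).
  - by apply: (neq B C b c) => // -> ->; case: (a \in C); case: (d \in C).
  - by apply: (neq B D b d) => // -> ->; case: (a \in D); case: (c \in D).
  - by apply: (neq C D c d) => // -> ->; case: (a \in D); case: (b \in D).
(* Four distinct children exclude a contracted root, which has only two. *)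
have MV : modular_vertex_pred e M.
  rewrite /modular_vertex_pred sM; apply/negP=> /andP[/eqP c2 /eqP MT].
  suff: size [:: A; B; C; D] <= size (enum (children e setT)) by rewrite -cardE c2.
  apply: uniq_leq_size uqN _ => X.
  by rewrite mem_enum -MT !in_cons orbF => /or4P[]/eqP->.
have [f' ff' f'f] := f_bij.
pose v := f' (exist _ M MV).
have fv : f v = exist _ M MV by exact: f'f.
have nv : is_node v.
  apply/contraT=> nn; case: T_glt => _ _ /(_ v)[/(_ nn)[x vx] _] _.
  have := f_leaf x; rewrite -vx fv => /(congr1 val) /= Mx.
  by rewrite Mx cards1 in M1.
have [_ g_im g_edge _] := f_lab v nv.
have lab N : N \in children e M -> exists2 m, m \in lverts v & Some N = g v m.
  move=> cN; apply/imsetP; rewrite g_im /= fv.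
  by rewrite in_set.
have [ma mav ga] := lab A cA; have [mb mbv gb] := lab B cB.
have [mc mcv gc] := lab C cC; have [md mdv gd] := lab D cD.
have /negP[] := clique_or_star_p4_free (T_cs v nv) mav mbv mcv mdv.
have uqm : uniq [:: ma; mb; mc; md].
  have uqS : uniq (map Some [:: A; B; C; D]) by rewrite map_inj_uniq // => ? ? [].
  by apply: (@map_uniq _ _ (g v)); rewrite [map _ _]/= -ga -gb -gc -gd.
rewrite /p4 uqm -!g_edge // -ga -gb -gc -gd fv.
have ed := quotient_edge_child e_sym.
move: uqN; rewrite /= !inE !negb_or !andbT => /and3P[/and3P[AB AC AD] /andP[BC BD] CD].
rewrite (ed M A B a b) // (ed M B C b c) // (ed M C D c d) // (ed M A C a c) //.
by rewrite (ed M B D b d) // (ed M A D a d) // eab ebc ecd eac ebd ead.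
Qed.

Theorem mainTheorem3 (V : finType) (e : rel V)
    (e_sym : symmetric e) (e_irr : irreflexive e) (e_conn : connected_graph e)
    (ST : glt V) (ST_split : is_split_tree e ST) :
  cograph e <-> glt_iso ST (modular_glt e) /\ clique_star_tree ST.
Proof.
split=> [e_cog|[ST_iso ST_cs]].
  split; first exact: split_tree_modular.
  by move=> v; apply: (cograph_label e_sym).
have ST_glt : is_glt ST by case: ST_split.
exact: modular_clique_star_cograph ST_iso ST_cs.
Qed.
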